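(* There exists $T_1\in(0,T_0]$, depending only on the coefficients $(H,F,g)$ (and on the fixed auxiliary number $\theta$), such that for every $0<T\le T_1$, every $0<s<T$ and every $\mu\in\mathscr{P}(\mathbb{T}^d)$ the following holds. Let $\Sigma[s,\mu]=(\Sigma^1[s,\mu],\Sigma^2[s,\mu])$ be the solution of the Hamiltonian system described in the context, let $\sigma_t:=\Sigma^1[s,\mu](t,\cdot)_{\#}\mu$, let $X[s,\mu](t,\cdot)$ be the inverse of $q\mapsto\Sigma^1[s,\mu](t,q)$, and let $$U(t,q)=z(t,X[s,\mu](t,q)),$$ where for each $q$ the function $z(\cdot,q)$ satisfies $$\partial_t z(t,q)=\Sigma^2[s,\mu](t,q)\cdot\nabla_pH(\Sigma^1[s,\mu](t,q),\Sigma^2[s,\mu](t,q))-H(\Sigma^1[s,\mu](t,q),\Sigma^2[s,\mu](t,q))-F(\Sigma^1[s,\mu](t,q),\sigma_t)\quad\text{in }(0,T),$$ $$z(0,q)=g(\Sigma^1[s,\mu](0,q),\sigma_0).$$ Then the pair $(U,\sigma)$ is a classical solution to the first-order mean field game system on $\mathbb{T}^d$ with coefficients $(H,F,g)$ and parameters $s,\mu$.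
   Context: Conventions. $\mathbb{T}^d=\mathbb{R}^d/\mathbb{Z}^d$, $|x-y|_{\mathbb{T}^d}$ is the quotient distance. A function on $\mathbb{T}^d$ is a $\mathbb{Z}^d$-periodic function on $\mathbb{R}^d$; a function $f:\mathbb{T}^d\to\mathbb{T}^d$ is a function $f:\mathbb{R}^d\to\mathbb{R}^d$ with $f(x)-f(y)\in\mathbb{Z}^d$ whenever $x-y\in\mathbb{Z}^d$. $\mathscr{P}(\mathbb{T}^d)$ is the space of Borel probability measures on $\mathbb{T}^d$ (represented by elements of $\mathscr{P}_2(\mathbb{R}^d)$, two of them being identified if they give the same integral to every continuous periodic function), with the metric $\mathscr{W}(\mu,\nu)=(\inf_{\gamma\in\Gamma(\mu,\nu)}\int|x-y|_{\mathbb{T}^d}^2\,\gamma(dx,dy))^{1/2}$, where $\Gamma(\mu,\nu)$ is the set of couplings and $\Gamma_0(\mu,\nu)$ the set of minimizing couplings. $f_{\#}\mu$ is the push-forward. $AC^2(0,T;\mathscr{P}(\mathbb{T}^d))$ is the set of paths $\sigma$ for which there is $m\in L^2(0,T)$ with $\mathscr{W}(\sigma_{t_1},\sigma_{t_2})\le\int_{t_1}^{t_2}m(\tau)d\tau$ for $0<t_1\le t_2<T$. Wasserstein gradient. $\mathcal{W}:\mathscr{P}(\mathbb{T}^d)\to\mathbb{R}$ is differentiable at $\mu$ if there is $\xi\in L^2(\mathbb{T}^d,\mu)$ such that $\sup\{|\mathcal{W}(\nu)-\mathcal{W}(\mu)-\int\xi(x)\cdot(y-x)\gamma(dx,dy)|/\|\pi^1-\pi^2\|_{\gamma}\}\to0$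 as $r\to0^+$, the supremum being over $\nu\in\mathscr{P}_2(\mathbb{R}^d)$ and $\gamma\in\Gamma_0(\mu,\nu)$ with $0<\|\pi^1-\pi^2\|_\gamma\le r$, where $\|\pi^1-\pi^2\|_\gamma=(\int|x-y|^2d\gamma)^{1/2}$. The gradient $\nabla_\mu\mathcal{W}(\mu)$ is the unique such $\xi$ of minimal $L^2(\mu)$-norm; it lies in $\mathscr{T}_\mu\mathscr{P}(\mathbb{T}^d)$, the $L^2(\mu)$-closure of gradients of smooth periodic functions. Vector-valued functions are treated componentwise. Assumptions on $(H,F,g)$. $H=H(q,p)\in C^3(\mathbb{T}^d\times\mathbb{R}^d)$. $F=F(q,\mu)$ on $\mathbb{T}^d\times\mathscr{P}(\mathbb{T}^d)$ is continuous in $\mu$ and $C^3$ in $q$; there is $\kappa>0$ with $|\nabla_qF|,|\nabla^2_{qq}F|,|\nabla^3_{qqq}F|\le\kappa$ and $|\nabla_qF(q_1,\mu_1)-\nabla_qF(q_2,\mu_2)|\le\kappa\sqrt{|q_1-q_2|^2+\mathscr{W}^2(\mu_1,\mu_2)}$; and $\nabla_qF(q,\cdot)$ is differentiable at every $\mu$, for every $q$, with $\nabla_\mu\nabla_qF(q,\mu)(x)$ continuous in $(q,\mu,x)$. $g$ satisfies exactly the same conditions as $F$ (same $\kappa$). The class $\mathcal{M}_0$. For positive constants, $\mathcal{M}_0(A_1,A_2,B,E,E_1,E_2,T)$ is the set of continuous $Z=(Q,P):[0,T]\times\mathbb{T}^d\to\mathbb{T}^d\times\mathbb{R}^d$ lying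 in $W^{2,2;\infty}$ (essentially bounded weak derivatives up to second order in $t$ and up to second order in $q$) with sup-norm bounds: $|\partial_tQ|,|\nabla_qQ|,|\nabla^2_{qq}Q|\le A_1$; $|\partial_tP|,|\nabla_qP|,|\nabla^2_{qq}P|\le A_2$; $|P|\le B$; $|\nabla_qQ(0,\cdot)|,|\nabla^2_{qq}Q(0,\cdot)|\le E$; $|\partial^2_{tt}Q|\le E_1$; $|\partial^2_{tt}P|\le E_2$ (Euclidean norms). Standing construction of $\Sigma[s,\mu]$. Fix $\theta>2\kappa$. Positive constants $A_1,A_2,B,E,E_1,E_2$ and $T_0$, depending only on $(H,F,g)$ and $\theta$, are fixed (they exist) so that for every $0<T\le T_0$, $s\in[0,T]$, $\mu\in\mathscr{P}(\mathbb{T}^d)$ the system $$\partial_tQ=\nabla_pH(Q,P),\quad \partial_tP=-\nabla_qH(Q,P)-\nabla_qF(Q,Q(t,\cdot)_\#\mu),\quad Q(s,q)=q,\quad P(0,q)=\nabla_qg(Q(0,q),Q(0,\cdot)_\#\mu)$$ on $[0,T]\times\mathbb{T}^d$ has exactly one solution in $\mathcal{M}_0(A_1,\theta A_2,\theta B,E,E_1,\theta E_2,T)$, denoted $\Sigma[s,\mu]=(\Sigma^1[s,\mu],\Sigma^2[s,\mu])$, and so that $q\mapsto\Sigma^1[s,\mu](t,q)$ is a $C^1$ diffeomorphism for every $t\in[0,T]$. Mean field game system and classical solution. The system with parameters $s,\mu$ is: $\partial_tU+H(q,\nabla_qU)+F(q,\sigma_t)=0$; $\partial_t\sigma_t+\mathrm{div}(\sigma_t\nabla_pH(q,\nabla_qU))=0$;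 $U(0,\cdot)=g(\cdot,\sigma_0)$; $\sigma_s=\mu$. A pair $U:(0,T)\times\mathbb{T}^d\to\mathbb{R}$, $\sigma:(0,T)\to\mathscr{P}(\mathbb{T}^d)$ is a classical solution if: $U\in C^1((0,T)\times\mathbb{T}^d)$; $\sigma\in AC^2(0,T;\mathscr{P}(\mathbb{T}^d))$ and for every $\varphi\in C_c^\infty((0,T)\times\mathbb{T}^d)$, $\int_0^T\int[\partial_t\varphi(t,q)+\nabla\varphi(t,q)\cdot\nabla_pH(q,\nabla_qU(t,q))]\sigma_t(dq)dt=0$; the first equation holds pointwise, together with $U(0,\cdot)=g(\cdot,\sigma_0)$ at $t=0$ and $\sigma_s=\mu$. *)

(* Defs.v *)
From HB Require Import structures.
From mathcomp Require Import all_boot all_order all_algebra.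
From mathcomp Require Import all_classical all_reals all_analysis.

Set Implicit Arguments.
Unset Strict Implicit.
Unset Printing Implicit Defensive.

Import Order.TTheory GRing.Theory Num.Theory.
Import numFieldNormedType.Exports.

Local Open Scope classical_set_scope.
Local Open Scope ring_scope.

(* Row vectors carry the sup norm in the library; [enorm] is the Euclidean one. *)
Definition dot (R : realType) (d : nat) (u v : 'rV[R]_d) : R :=
  \sum_(i < d) u 0 i * v 0 i.

Definition enorm (R : realType) (d : nat) (v : 'rV[R]_d) : R :=
  Num.sqrt (dot v v).

Definition ebase (R : realType) (d : nat) (i : 'I_d) : 'rV[R]_d := delta_mx 0 i.

(* iterD [:: v1; ...; vk] f = D_v1 (... (D_vk f)). *)
Definition iterD (R : realType) (V : normedModType R) (vs : seq V)
    (f : V -> R) : V -> R :=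
  foldr (fun (v : V) (h : V -> R) => (fun x => derive h x v)) f vs.

(* Class C^n on an open set D, by way of the Frechet differentiability of f and
   of its iterated directional derivatives. *)
Fixpoint classC (R : realType) (V : normedModType R) (n : nat) (D : set V)
    (f : V -> R) : Prop :=
  match n with
  | 0 => forall x, D x -> {for x, continuous f}
  | n'.+1 => (forall x, D x -> differentiable f x) /\
             (forall v : V, classC n' D (fun x => derive f x v))
  end.

Definition grad (R : realType) (d : nat) (f : 'rV[R]_d -> R) (x : 'rV[R]_d) :
  'rV[R]_d := \row_(i < d) derive f x (ebase R i).

(* Euclidean norm of the tensor of all k-th order partial derivatives. *)
Definition dnorm (R : realType) (d k : nat) (f : 'rV[R]_d -> R)
    (x : 'rV[R]_d) : R :=
  Num.sqrt (\sum_(w : k.-tuple 'I_d)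
    iterD [seq ebase R i | i <- w] f x ^+ 2).

Definition gradq (R : realType) (d : nat) (H : 'rV[R]_d -> 'rV[R]_d -> R)
  (q p : 'rV[R]_d) : 'rV[R]_d := grad (H ^~ p) q.
Definition gradp (R : realType) (d : nat) (H : 'rV[R]_d -> 'rV[R]_d -> R)
  (q p : 'rV[R]_d) : 'rV[R]_d := grad (H q) p.

Definition Zlat (R : realType) (d : nat) : set 'rV[R]_d :=
  [set k | forall i, k 0 i \is a Num.int].

Definition periodic (R : realType) (d : nat) (Y : Type) (f : 'rV[R]_d -> Y) :=
  forall x k, Zlat k -> f (x + k) = f x.

Definition tdist (R : realType) (d : nat) (x y : 'rV[R]_d) : R :=
  inf [set enorm (x - y + k) | k in @Zlat R d].

Definition torus_map (R : realType) (d : nat) (f : 'rV[R]_d -> 'rV[R]_d) :=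
  forall x y, Zlat (x - y) -> Zlat (f x - f y).

(* Inverse on the torus, hence only modulo Z^d. *)
Definition torus_inverse (R : realType) (d : nat)
    (f h : 'rV[R]_d -> 'rV[R]_d) : Prop :=
  [/\ torus_map h, forall x, Zlat (h (f x) - x) & forall y, Zlat (f (h y) - y)].

Definition C1map (R : realType) (d : nat) (f : 'rV[R]_d -> 'rV[R]_d) : Prop :=
  forall i : 'I_d, classC 1 setT (fun x => f x 0 i).

Definition torus_C1_diffeo (R : realType) (d : nat)
    (f : 'rV[R]_d -> 'rV[R]_d) : Prop :=
  [/\ torus_map f, C1map f & exists2 h, torus_inverse f h & C1map h].

Definition borel_rV (R : realType) (d : nat) :=
  g_sigma_algebraType (@open 'rV[R]_d).

Record prob2 (R : realType) (d : nat) : Type := Prob2 {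
  prob2_measure :> probability (borel_rV R d) R ;
  prob2_moment :
    (\int[prob2_measure]_x ((enorm (x : 'rV[R]_d) ^+ 2)%:E) < +oo)%E }.

HB.instance Definition _ (R : realType) (d : nat) := gen_eqMixin (prob2 R d).
HB.instance Definition _ (R : realType) (d : nat) := gen_choiceMixin (prob2 R d).

(* Two elements of P_2(R^d) are the same point of P(T^d). *)
Definition torus_eq (R : realType) (d : nat) (mu nu : prob2 R d) : Prop :=
  forall phi : 'rV[R]_d -> R, continuous phi -> periodic phi ->
    \int[mu]_x phi x = \int[nu]_x phi x.

(* The push-forward f_# mu; the default value mu is taken only when f_# mu is
   not an element of P_2. *)
Definition push (R : realType) (d : nat) (f : 'rV[R]_d -> 'rV[R]_d)
    (mu : prob2 R d) : prob2 R d :=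
  xget mu [set nu : prob2 R d | forall A : set (borel_rV R d),
    measurable A -> nu A = mu (f @^-1` A)].

Definition coupling (R : realType) (d : nat) (mu nu : prob2 R d) :
    set (probability (borel_rV R d * borel_rV R d)%type R) :=
  [set gamma | forall A : set (borel_rV R d), measurable A ->
    gamma (A `*` setT) = mu A /\ gamma (setT `*` A) = nu A].

Definition tcost (R : realType) (d : nat)
    (gamma : probability (borel_rV R d * borel_rV R d)%type R) : \bar R :=
  (\int[gamma]_z ((tdist (z.1 : 'rV[R]_d) z.2 ^+ 2)%:E))%E.

Definition wass (R : realType) (d : nat) (mu nu : prob2 R d) : R :=
  Num.sqrt (fine (ereal_inf [set tcost gamma | gamma in coupling mu nu])).

Definition opt_coupling (R : realType) (d : nat) (mu nu : prob2 R d) :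
    set (probability (borel_rV R d * borel_rV R d)%type R) :=
  [set gamma | coupling mu nu gamma /\
    forall gamma', coupling mu nu gamma' -> (tcost gamma <= tcost gamma')%E].

Definition coupling_norm (R : realType) (d : nat)
    (gamma : probability (borel_rV R d * borel_rV R d)%type R) : R :=
  Num.sqrt (\int[gamma]_z (enorm ((z.1 : 'rV[R]_d) - z.2) ^+ 2)).

Definition sqnorm (R : realType) (d : nat) (mu : prob2 R d)
    (xi : 'rV[R]_d -> 'rV[R]_d) : \bar R :=
  (\int[mu]_x ((enorm (xi x) ^+ 2)%:E))%E.

Definition L2torus (R : realType) (d : nat) (mu : prob2 R d)
    (xi : 'rV[R]_d -> 'rV[R]_d) : Prop :=
  [/\ periodic xi,
      forall i : 'I_d,
        measurable_fun setT (fun x : borel_rV R d => xi x 0 i) &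
      (sqnorm mu xi < +oo)%E].

Definition wass_diff (R : realType) (d : nat) (W : prob2 R d -> R)
    (mu : prob2 R d) (xi : 'rV[R]_d -> 'rV[R]_d) : Prop :=
  L2torus mu xi /\
  forall eps : R, 0 < eps -> exists2 r : R, 0 < r &
    forall (nu : prob2 R d) gamma, opt_coupling mu nu gamma ->
      0 < coupling_norm gamma <= r ->
      `| W nu - W mu - \int[gamma]_z dot (xi z.1) (z.2 - z.1) | / coupling_norm gamma
        <= eps.

Definition wass_grad (R : realType) (d : nat) (W : prob2 R d -> R)
    (mu : prob2 R d) (xi : 'rV[R]_d -> 'rV[R]_d) : Prop :=
  wass_diff W mu xi /\
  forall eta, wass_diff W mu eta -> (sqnorm mu xi <= sqnorm mu eta)%E.

Definition Hassumption (R : realType) (d : nat)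
    (H : 'rV[R]_d -> 'rV[R]_d -> R) : Prop :=
  (forall p, periodic (H ^~ p)) /\
  classC 3 setT (fun z : 'rV[R]_d * 'rV[R]_d => H z.1 z.2).

(* In [Fa_wgrad], row i of the matrix G q mu x is the value at x of the
   Wasserstein gradient at mu of the i-th component of nabla_q F(q, .); this
   gradient is only defined mu-almost everywhere, and G is a continuous
   representative.  Measuring continuity with the quotient distances makes G a
   function on T^d x P(T^d) x T^d. *)
Record Fassumption (R : realType) (d : nat) (kappa : R)
    (F : 'rV[R]_d -> prob2 R d -> R) : Prop := {
  Fa_periodic : forall mu, periodic (F ^~ mu) ;
  Fa_torus_eq : forall q mu nu, torus_eq mu nu -> F q mu = F q nu ;
  Fa_continuous : forall q mu eps, 0 < eps -> exists2 delta : R, 0 < delta &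
    forall nu, wass mu nu < delta -> `| F q nu - F q mu | < eps ;
  Fa_C3 : forall mu, classC 3 setT (F ^~ mu) ;
  Fa_bound : forall (k : nat) q mu, (1 <= k <= 3)%N ->
    dnorm k (F ^~ mu) q <= kappa ;
  Fa_lipschitz : forall q1 mu1 q2 mu2,
    enorm (grad (F ^~ mu1) q1 - grad (F ^~ mu2) q2) <=
    kappa * Num.sqrt (enorm (q1 - q2) ^+ 2 + wass mu1 mu2 ^+ 2) ;
  Fa_wgrad : exists G : 'rV[R]_d -> prob2 R d -> 'rV[R]_d -> 'M[R]_d,
    (forall q mu (i : 'I_d),
       wass_grad (fun nu => grad (F ^~ nu) q 0 i) mu
         (fun x => row i (G q mu x))) /\
    (forall q mu x eps, 0 < eps -> exists2 delta : R, 0 < delta &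
       forall q' mu' x', tdist q q' < delta -> wass mu mu' < delta ->
         tdist x x' < delta -> `| G q' mu' x' - G q mu x | < eps) }.

(* d-dimensional Lebesgue (outer) measure. *)
Definition lebesgue_rV (R : realType) (d : nat) (A : set (borel_rV R d)) :
    \bar R :=
  ereal_inf [set s : \bar R | exists a b : nat -> 'rV[R]_d,
    [/\ forall n i, a n 0 i <= b n 0 i,
        A `<=` \bigcup_n [set x : 'rV[R]_d |
                           forall i, a n 0 i <= x 0 i <= b n 0 i] &
        s = (\sum_(0 <= n <oo) (\prod_(i < d) (b n 0 i - a n 0 i))%:E)%E]].

Record weak_setting (R : realType) (V : normedModType R) : Type := WeakSetting {
  ws_measurable : set (V -> R) ;
  ws_test : set (V -> R) ;
  ws_int : (V -> R) -> R }.

Definition weak_derivative (R : realType) (V : normedModType R)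
    (S : weak_setting V) (vs : seq V) (f h : V -> R) : Prop :=
  forall phi, ws_test S phi ->
    ws_int S (fun z => f z * iterD vs phi z) =
    (-1) ^+ size vs * ws_int S (fun z => h z * phi z).

(* The weak derivatives of Y along the lists of directions dirs j are
   essentially bounded, with Euclidean norm (over all components and all j) at
   most A almost everywhere; after modification on a null set of the
   representatives G, the bound holds everywhere. *)
Definition weak_bound (R : realType) (d : nat) (V : normedModType R)
    (S : weak_setting V) (J : finType) (dirs : J -> seq V)
    (Y : V -> 'rV[R]_d) (A : R) : Prop :=
  exists G : 'I_d -> J -> V -> R,
    [/\ forall i j, ws_measurable S (G i j),
        forall i j, weak_derivative S (dirs j) (fun z => Y z 0 i) (G i j) &
        forall z, Num.sqrt (\sum_(i < d) \sum_j G i j z ^+ 2) <= A].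

Definition smooth_compact (R : realType) (V : normedModType R) (D : set V)
    (phi : V -> R) : Prop :=
  (forall n, classC n setT phi) /\
  exists K : set V, [/\ compact K, K `<=` D & forall z, ~ K z -> phi z = 0].

Definition space (R : realType) (d : nat) : weak_setting 'rV[R]_d :=
  @WeakSetting R 'rV[R]_d
    [set f | measurable_fun setT (f : borel_rV R d -> R)]
    (smooth_compact setT)
    (fun f => fine (\int[@lebesgue_rV R d]_x (f x)%:E)%E).

(* (0,T) x R^d; the functions integrated below are bounded, Borel and
   compactly supported, so their integral is the iterated one. *)
Definition spacetime (R : realType) (d : nat) (T : R) :
    weak_setting (R * 'rV[R]_d)%type :=
  @WeakSetting R (R * 'rV[R]_d)%type
    [set f | measurable_fun setT (f : (R * borel_rV R d)%type -> R)]
    (smooth_compact [set z | 0 < z.1 < T])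
    (fun f => \int[lebesgue_measure]_(t in `]0, T[)
                 fine (\int[@lebesgue_rV R d]_x (f (t, x))%:E)%E).

Definition dir_t (R : realType) (d k : nat) (_ : 'I_1) :
  seq (R * 'rV[R]_d)%type := nseq k (1, 0).
Definition dir_q (R : realType) (d k : nat) (w : k.-tuple 'I_d) :
  seq (R * 'rV[R]_d)%type := [seq (0, ebase R i) | i <- w].
Definition dir_x (R : realType) (d k : nat) (w : k.-tuple 'I_d) :
  seq 'rV[R]_d := [seq ebase R i | i <- w].

Definition slab (R : realType) (d : nat) (T : R) : set (R * 'rV[R]_d)%type :=
  [set z | 0 <= z.1 <= T].

Record calM0 (R : realType) (d : nat) (A1 A2 B E E1 E2 T : R)
    (Q P : R -> 'rV[R]_d -> 'rV[R]_d) : Prop := {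
  M0_Q_torus : forall t, 0 <= t <= T -> torus_map (Q t) ;
  M0_P_torus : forall t, 0 <= t <= T -> periodic (P t) ;
  M0_Q_cont : {within @slab R d T, continuous (fun z => Q z.1 z.2)} ;
  M0_P_cont : {within @slab R d T, continuous (fun z => P z.1 z.2)} ;
  M0_dtQ : weak_bound (@spacetime R d T) (@dir_t R d 1) (fun z => Q z.1 z.2) A1 ;
  M0_dqQ : forall k : nat, (1 <= k <= 2)%N ->
    weak_bound (@spacetime R d T) (@dir_q R d k) (fun z => Q z.1 z.2) A1 ;
  M0_dtP : weak_bound (@spacetime R d T) (@dir_t R d 1) (fun z => P z.1 z.2) A2 ;
  M0_dqP : forall k : nat, (1 <= k <= 2)%N ->
    weak_bound (@spacetime R d T) (@dir_q R d k) (fun z => P z.1 z.2) A2 ;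
  M0_P : forall t q, 0 <= t <= T -> enorm (P t q) <= B ;
  M0_dqQ0 : forall k : nat, (1 <= k <= 2)%N ->
    weak_bound (@space R d) (@dir_x R d k) (Q 0) E ;
  M0_dttQ : weak_bound (@spacetime R d T) (@dir_t R d 2) (fun z => Q z.1 z.2) E1 ;
  M0_dttP : weak_bound (@spacetime R d T) (@dir_t R d 2) (fun z => P z.1 z.2) E2 }.

(* The equations are required on (0,T); at t = 0 and t = T they follow from the
   continuity built in [calM0]. *)
Record ham_system (R : realType) (d : nat) (H : 'rV[R]_d -> 'rV[R]_d -> R)
    (F g : 'rV[R]_d -> prob2 R d -> R) (T s : R) (mu : prob2 R d)
    (Q P : R -> 'rV[R]_d -> 'rV[R]_d) : Prop := {
  ham_Q : forall t q, 0 < t < T ->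
    is_derive t 1 (Q ^~ q) (gradp H (Q t q) (P t q)) ;
  ham_P : forall t q, 0 < t < T ->
    is_derive t 1 (P ^~ q)
      (- gradq H (Q t q) (P t q) - grad (F ^~ (push (Q t) mu)) (Q t q)) ;
  ham_s : forall q, Q s q = q ;
  ham_0 : forall q, P 0 q = grad (g ^~ (push (Q 0) mu)) (Q 0 q) }.

Definition is_Sigma (R : realType) (d : nat) (H : 'rV[R]_d -> 'rV[R]_d -> R)
    (F g : 'rV[R]_d -> prob2 R d -> R) (theta A1 A2 B E E1 E2 T s : R)
    (mu : prob2 R d) (Q P : R -> 'rV[R]_d -> 'rV[R]_d) : Prop :=
  calM0 A1 (theta * A2) (theta * B) E E1 (theta * E2) T Q P /\
  ham_system H F g T s mu Q P.

Definition standing (R : realType) (d : nat) (H : 'rV[R]_d -> 'rV[R]_d -> R)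
    (F g : 'rV[R]_d -> prob2 R d -> R) (theta A1 A2 B E E1 E2 T0 : R) : Prop :=
  forall (T s : R) (mu : prob2 R d), 0 < T <= T0 -> 0 <= s <= T ->
    [/\ exists Q P, is_Sigma H F g theta A1 A2 B E E1 E2 T s mu Q P,
        forall Q P Q' P',
          is_Sigma H F g theta A1 A2 B E E1 E2 T s mu Q P ->
          is_Sigma H F g theta A1 A2 B E E1 E2 T s mu Q' P' ->
          forall t q, 0 <= t <= T -> Q t q = Q' t q /\ P t q = P' t q &
        forall Q P, is_Sigma H F g theta A1 A2 B E E1 E2 T s mu Q P ->
          forall t, 0 <= t <= T -> torus_C1_diffeo (Q t)].

Definition AC2 (R : realType) (d : nat) (T : R) (sigma : R -> prob2 R d) :
    Prop :=
  exists m : R -> R,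
    [/\ measurable_fun `]0, T[ m,
        (\int[lebesgue_measure]_(t in `]0%R, T[) ((m t ^+ 2)%:E) < +oo)%E &
        forall t1 t2, 0 < t1 -> t1 <= t2 -> t2 < T ->
          wass (sigma t1) (sigma t2) <=
          \int[lebesgue_measure]_(t in `[t1, t2]) m t].

(* C_c^infty((0,T) x T^d): the support is compact in the time variable only. *)
Definition torus_test (R : realType) (d : nat) (T : R)
    (phi : (R * 'rV[R]_d)%type -> R) : Prop :=
  [/\ forall n, classC n setT phi,
      forall t, periodic (fun q => phi (t, q)) &
      exists a b : R, [/\ 0 < a, b < T &
        forall t q, ~~ (a <= t <= b) -> phi (t, q) = 0]].

(* U and sigma live on (0,T); their values at t = 0 are their limits as
   t -> 0+. *)
Record classical_solution (R : realType) (d : nat)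
    (H : 'rV[R]_d -> 'rV[R]_d -> R) (F g : 'rV[R]_d -> prob2 R d -> R)
    (T s : R) (mu : prob2 R d) (U : R -> 'rV[R]_d -> R)
    (sigma : R -> prob2 R d) : Prop := {
  cs_periodic : forall t, 0 < t < T -> periodic (U t) ;
  cs_C1 : classC 1 [set z : (R * 'rV[R]_d)%type | 0 < z.1 < T]
    (fun z => U z.1 z.2) ;
  cs_AC2 : AC2 T sigma ;
  cs_continuity : forall phi, torus_test T phi ->
    \int[lebesgue_measure]_(t in `]0, T[)
      (\int[sigma t]_q
         (derive (fun t' => phi (t', q)) t 1 +
          dot (grad (fun q' => phi (t, q')) q) (gradp H q (grad (U t) q)))) = 0 ;
  cs_HJ : forall t q, 0 < t < T ->
    derive (U ^~ q) t 1 + H q (grad (U t) q) + F q (sigma t) = 0 ;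
  cs_init : forall q, U 0 q = g q (sigma 0) ;
  cs_U_trace : forall q, U t q @[t --> 0^'+] --> U 0 q ;
  cs_sigma_trace : wass (sigma t) (sigma 0) @[t --> 0^'+] --> (0 : R) ;
  cs_s : torus_eq (sigma s) mu }.

(* Main.v *)
Require Import Defs.
From HB Require Import structures.
From mathcomp Require Import all_boot all_order all_algebra.
From mathcomp Require Import all_classical all_reals all_analysis.
From mathcomp Require Import measurable_realfun ring lra.
Require Import Defs.

Set Implicit Arguments.
Unset Strict Implicit.
Unset Printing Implicit Defensive.

Import Order.TTheory GRing.Theory Num.Theory.
Import numFieldNormedType.Exports.

Local Open Scope classical_set_scope.
Local Open Scope ring_scope.

(** The proof is the method of characteristics, carried out by comparing two
    trajectories.  Write Q, P for the two components of Sigma, and for two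
    labels q, q' put m(t) = |Q(t,q') - Q(t,q)|^2 and
    n(t) = m(t) + |P(t,q') - P(t,q)|^2.

    Stability.  On the strip |p| <= theta B the gradients of H are L-Lipschitz,
    because H is C^2 and periodic in q; those of F and g are kappa-Lipschitz.
    With K = 1 + L + kappa this gives |m'| <= 4 K n and |n'| <= 8 K n, and the
    initial condition P(0) = grad g (Q(0)) gives n(0) <= K^2 m(0).  When
    16 K^3 T <= 1, the value of n at any time is therefore at most 4 K^2 times
    the value of m at any other time ([flow_lipschitz]): the flow has a Lipschitz
    inverse Y and the momentum is a Lipschitz function of the position.  The
    smallness of T serves only here, and K depends on H, kappa, theta and B only.

    Value function.  In the time derivative of the defect
    z(t,q') - z(t,q) - P(t,q).(Q(t,q') - Q(t,q)) all first order terms cancel, by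
    the Hamiltonian system and the equation of z; it vanishes to second order at
    t = 0 since P(0) is the gradient of g.  Hence it is O(m(t))
    ([action_taylor]).  Since U(t,Q(t,q)) = z(t,q), this says that
      U(t,x) = z(t,q) + P(t,q).(x - Q(t,q)) + O(|x - Q(t,q)|^2)
    with a constant independent of t.  For a fixed label q the main part is
    differentiable in (t,x), because t -> (z,P,Q)(t,q) is; so U is differentiable
    with grad U = P(t,Y(t,x)) and d_t U = - H - F ([value_differentiable]), and
    these expressions are continuous.

    Torus.  The map t -> Q(t,q+k) - Q(t,q) is continuous with values in Z^d, and
    it equals k at t = s.  So Q commutes with lattice translations, z is periodic,
    and the given X, which inverts Q modulo Z^d only, may be replaced by Y.

    Measures.  The image of mu by (Q(t),Q(u)) is a coupling of sigma_t and
    sigma_u, so sigma is Lipschitz for the Wasserstein distance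
    ([wass_le_of_transport]).  The weak continuity equation is the integral over
    (0,T) of the derivative of t -> int phi(t,Q(t,q)) mu(dq), a function which
    vanishes near both ends ([continuity_equation]). *)

(** * Euclidean structure of row vectors *)

Section Euclid.
Variables (R : realType) (d : nat).
Implicit Types u v w : 'rV[R]_d.

Lemma dotC u v : dot u v = dot v u.
Proof. by apply: eq_bigr => i _; rewrite mulrC. Qed.

Lemma dotDl u v w : dot (u + v) w = dot u w + dot v w.
Proof. by rewrite -big_split; apply: eq_bigr => i _; rewrite mxE mulrDl. Qed.

Lemma dotDr u v w : dot w (u + v) = dot w u + dot w v.
Proof. by rewrite dotC dotDl !(dotC w). Qed.

Lemma dotZl a u v : dot (a *: u) v = a * dot u v.
Proof. by rewrite mulr_sumr; apply: eq_bigr => i _; rewrite mxE mulrA. Qed.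

Lemma dotZr a u v : dot u (a *: v) = a * dot u v.
Proof. by rewrite dotC dotZl dotC. Qed.

Lemma dotNl u v : dot (- u) v = - dot u v.
Proof. by rewrite -scaleN1r dotZl mulN1r. Qed.

Lemma dotNr u v : dot u (- v) = - dot u v.
Proof. by rewrite dotC dotNl dotC. Qed.

Lemma dotBl u v w : dot (u - v) w = dot u w - dot v w.
Proof. by rewrite dotDl dotNl. Qed.

Lemma dotBr u v w : dot w (u - v) = dot w u - dot w v.
Proof. by rewrite dotDr dotNr. Qed.

Lemma dot_ge0 u : 0 <= dot u u.
Proof. by apply: sumr_ge0 => i _; rewrite -expr2 sqr_ge0. Qed.

Lemma sqr_enorm u : enorm u ^+ 2 = dot u u.
Proof. by rewrite sqr_sqrtr ?dot_ge0. Qed.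

Lemma enorm_ge0 u : 0 <= enorm u.
Proof. exact: sqrtr_ge0. Qed.

Lemma dot0l u : dot 0 u = 0.
Proof. by rewrite -(scale0r 0) dotZl mul0r. Qed.

Lemma dot_eq0 u : dot u u = 0 -> u = 0.
Proof.
move/eqP; rewrite psumr_eq0; last by move=> i _; rewrite -expr2 sqr_ge0.
move/allP => h; apply/rowP => i; rewrite mxE.
by have := h i (mem_index_enum i); rewrite /= mulf_eq0 orbb => /eqP.
Qed.

Lemma sqr_coord_le u i : u 0 i ^+ 2 <= dot u u.
Proof.
rewrite /dot (bigD1 i) //= -expr2 lerDl.
by apply: sumr_ge0 => j _; rewrite -expr2 sqr_ge0.
Qed.

Lemma coord_le_enorm u i : `|u 0 i| <= enorm u.
Proof. by rewrite -sqrtr_sqr ler_wsqrtr // sqr_coord_le. Qed.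

Lemma norm_le_enorm u : `|u| <= enorm u.
Proof.
rewrite [leLHS]mx_normrE; apply: bigmax_le; first exact: enorm_ge0.
by move=> -[i j] _ /=; rewrite (ord1 i) coord_le_enorm.
Qed.

Lemma coord_le_norm u i : `|u 0 i| <= `|u|.
Proof. by rewrite [leRHS]mx_normrE; exact: (le_bigmax _ _ (0, i)). Qed.

Lemma abs_dot_le u v : `|dot u v| <= enorm u * enorm v.
Proof.
rewrite -ler_sqr ?nnegrE ?mulr_ge0 ?enorm_ge0 // exprMn !sqr_enorm.
rewrite real_normK ?num_real //.
have [/dot_eq0 ->|v0] := eqVneq (dot v v) 0.
  by rewrite dotC dot0l expr2 mul0r mulr_ge0 // dot_ge0.
have {}v0 : 0 < dot v v by rewrite lt_def v0 dot_ge0.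
have := dot_ge0 (dot v v *: u - dot u v *: v).
rewrite dotBl !dotBr !dotZl !dotZr (dotC v u).
set a := dot u u; set b := dot u v; set c := dot v v in v0 *.
move=> h; rewrite -(ler_pM2l v0).
by rewrite -subr_ge0; apply: le_trans h _; rewrite le_eqVlt; apply/orP; left;
  apply/eqP; ring.
Qed.

Lemma enorm0 : enorm (0 : 'rV[R]_d) = 0.
Proof. by rewrite /enorm dot0l sqrtr0. Qed.

Lemma enormN u : enorm (- u) = enorm u.
Proof. by rewrite /enorm dotNl dotNr opprK. Qed.

Lemma enormZ a u : enorm (a *: u) = `|a| * enorm u.
Proof.
by rewrite /enorm dotZl dotZr mulrA -expr2 sqrtrM ?sqr_ge0 // sqrtr_sqr.
Qed.

Lemma enormBC u v : enorm (u - v) = enorm (v - u).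
Proof. by rewrite -enormN opprB. Qed.

Lemma enormD u v : enorm (u + v) <= enorm u + enorm v.
Proof.
rewrite -ler_sqr ?nnegrE ?addr_ge0 ?enorm_ge0 // sqr_enorm dotDl !dotDr.
have /ler_normlP[_ h] := abs_dot_le u v.
rewrite sqrrD !sqr_enorm (dotC v u); lra.
Qed.

Lemma dot_le_norm u : dot u u <= d%:R * `|u| ^+ 2.
Proof.
apply: (@le_trans _ _ (\sum_(i < d) `|u| ^+ 2)).
  apply: ler_sum => i _; rewrite -expr2 -[leLHS]real_normK ?num_real //.
  by rewrite ler_sqr ?nnegrE // coord_le_norm.
by rewrite sumr_const card_ord mulr_natl.
Qed.

Lemma enorm_le_norm u : enorm u <= d%:R * `|u|.
Proof.
rewrite -ler_sqr ?nnegrE ?mulr_ge0 ?enorm_ge0 // sqr_enorm.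
apply: le_trans (dot_le_norm u) _; rewrite exprMn ler_wpM2r ?sqr_ge0 //.
by rewrite -natrX ler_nat; case: d => // n; rewrite -mulnn leq_pmulr.
Qed.

End Euclid.

Section DotCalculus.
Variables (R : realType) (d : nat) (V : normedModType R).

Lemma is_derive_coord m n (f : V -> 'M[R]_(m, n)) (x v : V) df i j :
  is_derive x v f df -> is_derive x v (fun y => f y i j) (df i j).
Proof.
move=> [fd <-]; have fdij := proj1 (derivable_mxP f x v) fd i j.
by apply: DeriveDef => //; rewrite (derive_mx fd) mxE.
Qed.

Lemma is_derive_dot (f h : V -> 'rV[R]_d) (x v : V) df dh :
  is_derive x v f df -> is_derive x v h dh ->
  is_derive x v (fun y => dot (f y) (h y)) (dot df (h x) + dot (f x) dh).
Proof.
move=> fd hd.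
have fdi i := is_derive_coord 0 i fd; have hdi i := is_derive_coord 0 i hd.
have -> : (fun y => dot (f y) (h y)) =
   \sum_(i < d) ((fun y => f y 0 i) * (fun y => h y 0 i)).
  by apply/funext => y; rewrite fct_sumE.
apply: is_derive_eq.
rewrite -big_split; apply: eq_bigr => i _.
by rewrite /GRing.scale /=; ring.
Qed.

Lemma differentiable_dot (f h : V -> 'rV[R]_d) x :
  differentiable f x -> differentiable h x ->
  differentiable (fun y => dot (f y) (h y)) x.
Proof.
move=> fd hd.
have cd (k : V -> 'rV[R]_d) i : differentiable k x ->
    differentiable (fun y => k y 0 i) x.
  move=> kd; apply: (@differentiable_comp _ _ _ _ k (fun M : 'rV[R]_d => M 0 i)) => //.
  exact: differentiable_coord.
have -> : (fun y => dot (f y) (h y)) =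
   \sum_(i < d) ((fun y => f y 0 i) * (fun y => h y 0 i)).
  by apply/funext => y; rewrite fct_sumE.
by apply: differentiable_sum => i; apply: differentiableM; exact: cd.
Qed.

End DotCalculus.

Section ContinuousDot.
Variables (R : realType) (d : nat).

Lemma cvg_coord (T : Type) (G : set_system T) {FG : Filter G} m n
    (f : T -> 'M[R]_(m, n)) (l : 'M[R]_(m, n)) i j :
  f x @[x --> G] --> l -> f x i j @[x --> G] --> l i j.
Proof.
move=> fl; apply: (continuous_cvg _ (h := fun M : 'M[R]_(m, n) => M i j)) fl.
exact: coord_continuous.
Qed.

Lemma cvg_dot_coord (T : Type) (G : set_system T) {FG : Filter G}
    (f h : T -> 'rV[R]_d) (a b : 'rV[R]_d) :
  (forall i, f x 0 i * h x 0 i @[x --> G] --> a 0 i * b 0 i) ->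
  dot (f x) (h x) @[x --> G] --> dot a b.
Proof.
by move=> fh; apply: cvg_big => [|i _]; [exact: add_continuous|exact: fh].
Qed.

Lemma cvg_dot (T : Type) (G : set_system T) {FG : Filter G}
    (f h : T -> 'rV[R]_d) a b :
  f x @[x --> G] --> a -> h x @[x --> G] --> b ->
  dot (f x) (h x) @[x --> G] --> dot a b.
Proof.
by move=> fa hb; apply: cvg_dot_coord => i; apply: cvgM; exact: cvg_coord.
Qed.

Lemma cvg_enorm (T : Type) (G : set_system T) {FG : Filter G}
    (f : T -> 'rV[R]_d) a :
  f x @[x --> G] --> a -> enorm (f x) @[x --> G] --> enorm a.
Proof.
move=> fa.
have := continuous_cvg _ (@sqrt_continuous R (dot a a)) (cvg_dot fa fa).
exact.
Qed.

Lemma cvg_enorm0P (T : Type) (G : set_system T) {FG : Filter G}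
    (f : T -> 'rV[R]_d) a :
  enorm (f x - a) @[x --> G] --> (0 : R) -> f x @[x --> G] --> a.
Proof.
move=> /cvgrPdist_le h; apply/cvgrPdist_le => e e0; move: (h e e0).
apply: filterS => x; rewrite sub0r normrN ger0_norm ?enorm_ge0 // => hx.
by rewrite distrC; apply: le_trans hx; exact: norm_le_enorm.
Qed.

End ContinuousDot.

(** * Directional derivatives and mean values *)

Section DirectionalDerivatives.
Variables (R : realType).

(** The two difference quotients are the same function of h, so no
    differentiability is involved.  Derivatives along lines, partial derivatives
    and invariance under translations are all instances. *)
Lemma derive_affine_comp (U V W : normedModType R) (f : V -> W) (g : U -> V)
    x u v : (forall h : R, g (h *: u + x) = h *: v + g x) ->
  (derivable (fun y => f (g y)) x u <-> derivable f (g x) v) /\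
  derive (fun y => f (g y)) x u = derive f (g x) v.
Proof.
move=> gE; rewrite /derivable /derive.
have -> : (fun h : R => h^-1 *: (((fun y => f (g y)) \o shift x) (h *: u) - f (g x)))
   = (fun h : R => h^-1 *: ((f \o shift (g x)) (h *: v) - f (g x))).
  by apply/funext => h; rewrite /= gE.
by split.
Qed.

Lemma derive_translation (V W : normedModType R) (f : V -> W) k x v :
  (forall y, f (y + k) = f y) -> derive f (x + k) v = derive f x v.
Proof.
move=> fk; have gE (h : R) : (h *: v + x) + k = h *: v + (x + k) by rewrite addrA.
have [_ <-] := derive_affine_comp f (g := fun y => y + k) gE.
by congr (derive _ _ _); apply/funext.
Qed.

Lemma is_derive_line (V : normedModType R) (f : V -> R) a v (t : R) :
  differentiable f (a + t *: v) ->
  is_derive t 1 (fun s : R => f (a + s *: v)) (derive f (a + t *: v) v).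
Proof.
move=> fd.
have gE (h : R) : a + (h *: 1 + t) *: v = h *: v + (a + t *: v).
  by rewrite scalerDl /GRing.scale /= mulr1 addrCA.
have [h1 h2] := @derive_affine_comp _ _ _ f (fun s : R => a + s *: v) t 1 v gE.
by apply: DeriveDef; [apply/h1; exact: diff_derivable|rewrite h2].
Qed.

Lemma mvt_segment (V : normedModType R) (f : V -> R) a b :
  (forall x, differentiable f x) ->
  exists2 s : R, 0 <= s <= 1 &
    f b - f a = derive f (a + s *: (b - a)) (b - a).
Proof.
move=> fd.
have dl (t : R) : is_derive t 1 (fun s : R => f (a + s *: (b - a)))
    (derive f (a + t *: (b - a)) (b - a)) by exact: is_derive_line.
have [|c cab] := @MVT R (fun s : R => f (a + s *: (b - a)))
  (fun t => derive f (a + t *: (b - a)) (b - a)) 0 1 ltr01 (fun x _ => dl x).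
  apply: continuous_subspaceT => x; apply: differentiable_continuous.
  by apply/derivable1_diffP; have [] := dl x.
rewrite scale1r scale0r addr0 [a + (b - a)]addrC subrK subr0 mulr1 => ->.
by exists c => //; move: cab; rewrite in_itv /= => /andP[/ltW -> /ltW ->].
Qed.

Lemma derive_dot d (f : 'rV[R]_d -> R) x v :
  differentiable f x -> derive f x v = dot (grad f x) v.
Proof.
move=> fd; rewrite deriveE // [in LHS](row_sum_delta v) linear_sum /=.
apply: eq_bigr => i _; rewrite linearZ mxE deriveE //= /GRing.scale /=.
by rewrite mulrC.
Qed.

Lemma mvt_grad d (f : 'rV[R]_d -> R) a b :
  (forall x, differentiable f x) ->
  exists2 s : R, 0 <= s <= 1 &
    f b - f a = dot (grad f (a + s *: (b - a))) (b - a).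
Proof.
move=> fd; have [s s01 ->] := mvt_segment a b fd.
by exists s => //; rewrite derive_dot.
Qed.

Lemma taylor_grad d (f : 'rV[R]_d -> R) (L : R) :
  (forall x, differentiable f x) ->
  (forall x y, enorm (grad f x - grad f y) <= L * enorm (x - y)) ->
  forall a b, `|f b - f a - dot (grad f a) (b - a)| <= L * enorm (b - a) ^+ 2.
Proof.
move=> fd fL a b; have [s /andP[s0 s1] ->] := mvt_grad a b fd.
rewrite -dotBl; apply: le_trans (abs_dot_le _ _) _.
rewrite expr2 mulrA ler_wpM2r ?enorm_ge0 //.
apply: le_trans (fL _ _) _; rewrite addrC addKr enormZ (ger0_norm s0).
have L0 : 0 <= L * enorm (b - a) := le_trans (enorm_ge0 _) (fL b a).
by rewrite mulrCA ler_piMl.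
Qed.

End DirectionalDerivatives.

Section TimeSpace.
Variables (R : realType) (d : nat).
Local Notation sp := (R * 'rV[R]_d)%type.
Implicit Types phi : sp -> R.

Lemma derive_time phi t x :
  derive (fun t' => phi (t', x)) t 1 = derive phi (t, x) (1, 0).
Proof.
have gE (h : R) : (h *: 1 + t, x) = h *: (1, 0) + (t, x) :> sp.
  by apply: injective_projections => //=; rewrite scaler0 add0r.
exact: (derive_affine_comp phi (g := fun t' => (t', x)) gE).2.
Qed.

Lemma derive_space phi t x b :
  derive (fun x' => phi (t, x')) x b = derive phi (t, x) (0, b).
Proof.
have gE (h : R) : (t, h *: b + x) = h *: (0, b) + (t, x) :> sp.
  by apply: injective_projections => //=; rewrite scaler0 add0r.
exact: (derive_affine_comp phi (g := fun x' => (t, x')) gE).2.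
Qed.

Lemma grad_space phi t x :
  grad (fun x' => phi (t, x')) x = \row_i derive phi (t, x) (0, ebase R i).
Proof. by apply/rowP => i; rewrite !mxE derive_space. Qed.

End TimeSpace.

Section PhaseSpace.
Variables (R : realType) (d : nat).
Local Notation ph := ('rV[R]_d * 'rV[R]_d)%type.
Implicit Types (H : 'rV[R]_d -> 'rV[R]_d -> R) (f : ph -> R).

Lemma gradqE H q p :
  gradq H q p = \row_i derive (fun z : ph => H z.1 z.2) (q, p) (ebase R i, 0).
Proof.
apply/rowP => i; rewrite !mxE; set e := ebase R i.
have gE (h : R) : (h *: e + q, p) = h *: (e, 0) + (q, p) :> ph.
  by apply: injective_projections => //=; rewrite scaler0 add0r.
exact: (derive_affine_comp (fun z : ph => H z.1 z.2) (g := fun x => (x, p)) gE).2.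
Qed.

Lemma gradpE H q p :
  gradp H q p = \row_i derive (fun z : ph => H z.1 z.2) (q, p) (0, ebase R i).
Proof.
apply/rowP => i; rewrite !mxE; set e := ebase R i.
have gE (h : R) : (q, h *: e + p) = h *: (0, e) + (q, p) :> ph.
  by apply: injective_projections => //=; rewrite scaler0 add0r.
exact: (derive_affine_comp (fun z : ph => H z.1 z.2) (g := fun x => (q, x)) gE).2.
Qed.

Lemma derive_pair f z a b : differentiable f z ->
  derive f z (a, b) = dot (\row_i derive f z (ebase R i, 0)) a +
                      dot (\row_i derive f z (0, ebase R i)) b.
Proof.
move=> fd; rewrite deriveE //.
have -> : (a, b) = \sum_i a 0 i *: (ebase R i, 0) +
                   \sum_i b 0 i *: (0, ebase R i) :> ph.
  apply: injective_projections => /=.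
    rewrite (@raddf_sum _ _ fst) (@raddf_sum _ _ fst) /=.
    rewrite [X in _ + X]big1 ?addr0 -?row_sum_delta // => i _.
    by rewrite scaler0.
  rewrite (@raddf_sum _ _ snd) (@raddf_sum _ _ snd) /=.
  rewrite [X in X + _]big1 ?add0r -?row_sum_delta // => i _.
  by rewrite scaler0.
rewrite linearD !linear_sum /=; congr (_ + _); apply: eq_bigr => i _;
  by rewrite linearZ mxE deriveE //= /GRing.scale /= mulrC.
Qed.

End PhaseSpace.

(** * Periodic functions and the gradients of the Hamiltonian *)

Section Lattice.
Variables (R : realType) (d : nat).
Implicit Types k l : 'rV[R]_d.

Lemma Zlat0 : Zlat (0 : 'rV[R]_d).
Proof. by move=> i; rewrite mxE rpred0. Qed.

Lemma ZlatN k : Zlat k -> Zlat (- k).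
Proof. by move=> hk i; rewrite mxE rpredN. Qed.

Lemma unit_cube_representative (x : 'rV[R]_d) :
  exists2 k, Zlat k & forall i, 0 <= (x + k) 0 i <= 1.
Proof.
exists (\row_i - (Num.floor (x 0 i))%:~R).
  by move=> i; rewrite mxE rpredN intr_int.
move=> i; rewrite !mxE subr_ge0 lerBlDl.
have /andP[-> /ltW /=] := floor_itv (x 0 i).
by rewrite intrD addrC.
Qed.

Lemma compact_box (a b : R) :
  compact [set v : 'rV[R]_d | forall i, a <= v 0 i <= b].
Proof.
have := @rV_compact R d (fun=> `[a, b]%classic) (fun=> @segment_compact R a b).
suff -> : [set v : 'rV[R]_d | forall i, `[a, b]%classic (v ord0 i)] =
  [set v : 'rV[R]_d | forall i, a <= v 0 i <= b] by [].
by apply/seteqP; split => v /= h i; have := h i; rewrite /= in_itv.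
Qed.

Lemma periodic_bounded (U : topologicalType) (f : U -> 'rV[R]_d -> R)
    (K : set U) :
  compact K -> continuous (fun z : U * 'rV[R]_d => f z.1 z.2) ->
  (forall u, periodic (f u)) ->
  exists2 C : R, 0 <= C & forall u x, K u -> `|f u x| <= C.
Proof.
move=> cK cf pf.
have := compact_bounded (continuous_compact (f := fun z : U * 'rV[R]_d => f z.1 z.2)
  (continuous_subspaceT cf) (compact_setX cK (@compact_box 0 1))).
move=> [M [_ hM]]; exists (`|M| + 1) => [|u x Ku]; first exact: addr_ge0.
have [k kZ kx] := unit_cube_representative x.
rewrite -(pf u x k kZ); apply: (hM (`|M| + 1)); last by exists (u, x + k).
by apply: le_lt_trans (ler_norm _) _; rewrite ltrDl.
Qed.

Lemma enorm_le_coord (u : 'rV[R]_d) C :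
  (forall i, `|u 0 i| <= C) -> 0 <= C -> enorm u <= d%:R * C.
Proof.
move=> h C0; apply: le_trans (enorm_le_norm _) _; rewrite ler_wpM2l //.
rewrite [leLHS]mx_normrE; apply: bigmax_le => // -[i j] _ /=.
by rewrite (ord1 i).
Qed.

End Lattice.

Lemma finite_common_bound (R : realType) (n : nat) (T : Type) (D : set T)
    (f : 'I_n -> T -> R) :
  (forall i, exists2 C : R, 0 <= C & forall z, D z -> `|f i z| <= C) ->
  exists2 C : R, 0 <= C & forall i z, D z -> `|f i z| <= C.
Proof.
move=> h.
have /choice[C hC] : forall i, exists C : R,
    0 <= C /\ forall z, D z -> `|f i z| <= C.
  by move=> i; have [C C0 hC] := h i; exists C.
exists (\sum_i C i); first by apply: sumr_ge0 => i _; have [] := hC i.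
move=> i z Dz; apply: le_trans ((hC i).2 z Dz) _.
by rewrite (bigD1 i) //= lerDl sumr_ge0 // => j _; have [] := hC j.
Qed.

Section GradientLipschitz.
Variables (R : realType) (d : nat).
Local Notation ph := ('rV[R]_d * 'rV[R]_d)%type.
Implicit Types (f : ph -> R) (H : 'rV[R]_d -> 'rV[R]_d -> R).

Let qperiodic f := forall p, periodic (fun q => f (q, p)).

Lemma periodic_derive f e : qperiodic f -> qperiodic (fun z => derive f z e).
Proof.
move=> pf p q k kZ; have -> : (q + k, p) = (q, p) + (k, 0) :> ph.
  by apply: injective_projections => //=; rewrite addr0.
apply: derive_translation => -[y y'].
have -> : (y, y') + (k, 0) = (y + k, y') :> ph.
  by apply: injective_projections => //=; rewrite addr0.
exact: (pf y' y k kZ).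
Qed.

Lemma qperiodic_bounded f B : continuous f -> qperiodic f ->
  exists2 C : R, 0 <= C & forall z : ph, enorm z.2 <= B -> `|f z| <= C.
Proof.
move=> cf pf.
have cs : continuous (fun z : 'rV[R]_d * 'rV[R]_d => f (z.2, z.1)).
  move=> z; apply: (continuous_comp (g := f)); last exact: cf.
  exact: (cvg_pair cvg_snd cvg_fst).
have [C C0 hC] := @periodic_bounded R d _ (fun p q => f (q, p)) _
  (@compact_box R d (- B) B) cs pf.
exists C => // -[q p] /= hp; apply: hC => i; rewrite -ler_norml.
exact: le_trans (coord_le_enorm _ _) hp.
Qed.

(** The partial derivatives of f are bounded on the strip |p| <= B, which is
    compact modulo lattice translations in q; the strip is convex, so the mean
    value theorem applies along the segment from z to z'. *)
Lemma gradient_components_lipschitz f B :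
  (forall z, differentiable f z) -> qperiodic f ->
  (forall e z, {for z, continuous (fun z => derive f z e)}) ->
  exists2 L : R, 0 <= L & forall z z' : ph, enorm z.2 <= B -> enorm z'.2 <= B ->
    `|f z' - f z| <= L * (enorm (z'.1 - z.1) + enorm (z'.2 - z.2)).
Proof.
move=> fd pf cf.
have [Lq Lq0 hq] : exists2 C : R, 0 <= C & forall (i : 'I_d) (z : ph),
    enorm z.2 <= B -> `|derive f z (ebase R i, 0)| <= C.
  apply: (@finite_common_bound _ _ _ [set z : ph | enorm z.2 <= B]) => i.
  apply: qperiodic_bounded; first by move=> z; exact: cf.
  exact: periodic_derive.
have [Lp Lp0 hp] : exists2 C : R, 0 <= C & forall (i : 'I_d) (z : ph),
    enorm z.2 <= B -> `|derive f z (0, ebase R i)| <= C.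
  apply: (@finite_common_bound _ _ _ [set z : ph | enorm z.2 <= B]) => i.
  apply: qperiodic_bounded; first by move=> z; exact: cf.
  exact: periodic_derive.
exists (d%:R * (Lq + Lp)); first by rewrite mulr_ge0 ?addr_ge0.
move=> z z' hz hz'.
have [s /andP[s0 s1] ->] := mvt_segment z z' fd.
set y := z + _.
have hy : enorm y.2 <= B.
  have -> : y.2 = (1 - s) *: z.2 + s *: z'.2.
    by rewrite /y /= scalerBr scalerBl scale1r addrAC addrA.
  apply: le_trans (enormD _ _) _; rewrite !enormZ !ger0_norm ?subr_ge0 //.
  have -> : B = (1 - s) * B + s * B by ring.
  by apply: lerD; apply: ler_wpM2l; rewrite ?subr_ge0.
rewrite [z' - z]surjective_pairing derive_pair //.
have gq : enorm (\row_i derive f y (ebase R i, 0)) <= d%:R * Lq.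
  by apply: enorm_le_coord => // i; rewrite mxE; exact: hq.
have gp : enorm (\row_i derive f y (0, ebase R i)) <= d%:R * Lp.
  by apply: enorm_le_coord => // i; rewrite mxE; exact: hp.
apply: le_trans (ler_normD _ _) _; rewrite mulrDr.
have dL : d%:R * Lq <= d%:R * (Lq + Lp) by rewrite ler_wpM2l // lerDl.
have dL' : d%:R * Lp <= d%:R * (Lq + Lp) by rewrite ler_wpM2l // lerDr.
apply: lerD; apply: le_trans (abs_dot_le _ _) _; rewrite ler_wpM2r ?enorm_ge0 //.
  exact: le_trans gq dL.
exact: le_trans gp dL'.
Qed.

Lemma qperiodic_H H : Hassumption H -> qperiodic (fun z : ph => H z.1 z.2).
Proof. by move=> [pH _] p q k /pH; apply. Qed.

(** Each first partial derivative of H is again C^1 and periodic in q, so its own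
    partial derivatives are bounded on the strip. *)
Lemma hamiltonian_gradient_bounds H B : Hassumption H ->
  exists2 L : R, 0 <= L & forall q p q' p', enorm p <= B -> enorm p' <= B ->
   [/\ enorm (gradp H q p) <= L,
       enorm (gradq H q' p' - gradq H q p) <= L * (enorm (q' - q) + enorm (p' - p)) &
       enorm (gradp H q' p' - gradp H q p) <= L * (enorm (q' - q) + enorm (p' - p))].
Proof.
move=> hH; have pH := qperiodic_H hH; have [_ [_ cH]] := hH.
set Hz := fun z : ph => _ in pH cH.
pose De (e : ph) := fun z => derive Hz z e.
have dDe e z : differentiable (De e) z by have [h _] := cH e; exact: h.
have cDe e : continuous (De e).
  by move=> z; apply: differentiable_continuous; exact: dDe.
have cDDe e e' z : {for z, continuous (fun z => derive (De e) z e')}.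
  have [_ /(_ e') [h _]] := cH e.
  by apply: differentiable_continuous; exact: h.
have pDe e : qperiodic (De e) by exact: periodic_derive.
have lipDe e := gradient_components_lipschitz B (dDe e) (pDe e) (cDDe e).
have bDe e := qperiodic_bounded B (@cDe e) (@pDe e).
pose bd (e : ph) (C : R) := 0 <= C /\ forall z z' : ph, enorm z.2 <= B -> enorm z'.2 <= B ->
  `|De e z| <= C /\
  `|De e z' - De e z| <= C * (enorm (z'.1 - z.1) + enorm (z'.2 - z.2)).
have /choice[C hC] : forall e, exists C : R, bd e C.
  move=> e; have [C1 C10 h1] := lipDe e; have [C2 C20 h2] := bDe e.
  exists (C1 + C2); split; first exact: addr_ge0.
  move=> z z' hz hz'; split; first by apply: le_trans (h2 _ hz) _; rewrite lerDr.
  apply: le_trans (h1 _ _ hz hz') _.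
  by rewrite ler_wpM2r ?addr_ge0 ?enorm_ge0 // lerDl.
pose M := \sum_i (C (ebase R i, 0) + C (0, ebase R i)).
have C0 e : 0 <= C e := (hC e).1.
have M1 i : C (ebase R i, 0) <= M.
  rewrite /M (bigD1 i) //= -addrA lerDl addr_ge0 // sumr_ge0 // => j _.
  exact: addr_ge0.
have M2 i : C (0, ebase R i) <= M.
  rewrite /M (bigD1 i) //= addrAC lerDr addr_ge0 // sumr_ge0 // => j _.
  exact: addr_ge0.
have M0 : 0 <= M by apply: sumr_ge0 => i _; exact: addr_ge0.
exists (d%:R * M); first by rewrite mulr_ge0.
move=> q p q' p' hp hp'; rewrite !gradqE !gradpE.
have : 0 <= enorm (q' - q) + enorm (p' - p) by rewrite addr_ge0 ?enorm_ge0.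
set S := _ + _ => a0.
split; rewrite -?mulrA.
- apply: enorm_le_coord => // i; rewrite mxE; apply: le_trans (M2 i).
  exact: ((hC (0, ebase R i)).2 (q, p) (q, p) hp hp).1.
- apply: enorm_le_coord => [i|]; last exact: mulr_ge0.
  rewrite !mxE; apply: le_trans (ler_wpM2r a0 (M1 i)).
  exact: ((hC (ebase R i, 0)).2 (q, p) (q', p') hp hp').2.
- apply: enorm_le_coord => [i|]; last exact: mulr_ge0.
  rewrite !mxE; apply: le_trans (ler_wpM2r a0 (M2 i)).
  exact: ((hC (0, ebase R i)).2 (q, p) (q', p') hp hp').2.
Qed.


End GradientLipschitz.

(** * Stability of the characteristics *)

Lemma mvt_bound (R : realType) (f df : R -> R) (a b C : R) : a <= b ->
  (forall x, a < x < b -> is_derive x 1 f (df x)) ->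
  {within `[a, b], continuous f} ->
  (forall x, a < x < b -> `|df x| <= C) ->
  `|f b - f a| <= C * (b - a).
Proof.
rewrite le_eqVlt => /predU1P[-> _ _ _|ab fd fc hC].
  by rewrite !subrr normr0 mulr0.
have fd' x : x \in `]a, b[ -> is_derive x 1 f (df x).
  by rewrite in_itv /=; exact: fd.
have [c] := MVT ab fd' fc; rewrite in_itv /= => hc ->.
have ba : 0 <= b - a by rewrite subr_ge0 ltW.
by rewrite normrM (ger0_norm ba) ler_wpM2r // hC.
Qed.

(** The time derivative of the defect z' - z - p.(x' - x) between two
    characteristics, with u = x' - x.  Primed letters belong to the second one;
    [hpy] and [hqy] are the gradients of H at the intermediate point where the
    mean value theorem is applied to H.  Every term on the right hand side is
    a product of two increments or a Taylor remainder. *)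
Lemma action_defect_identity (R : realType) (d : nat)
    (p p' hp hp' hpy hq hqy gf u : 'rV[R]_d) (h h' f f' : R) :
  h' - h = dot hqy u + dot hpy (p' - p) ->
  (dot p' hp' - h' - f') - (dot p hp - h - f) -
    (dot (- hq - gf) u + dot p (hp' - hp)) =
  dot (hp' - hpy) (p' - p) + dot (hq - hqy) u - (f' - f - dot gf u).
Proof.
move/eqP; rewrite subr_eq => /eqP ->; rewrite !(dotBl, dotBr, dotNl).
by rewrite !(dotC _ p) !(dotC _ p'); ring.
Qed.

(** Here a and b are the position and momentum increments, and s locates the
    intermediate point on the segment between the two phase points. *)
Lemma action_defect_bound (R : realType) (a b s L kappa D1 D2 : R) :
  0 <= a -> 0 <= b -> 0 <= s -> s <= 1 -> 0 <= L -> 0 <= kappa ->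
  D1 <= L * ((1 - s) * a + (1 - s) * b) -> D2 <= L * (s * a + s * b) ->
  D1 * b + D2 * a + kappa * a ^+ 2 <=
  2 * (1 + L + kappa) * (a ^+ 2 + b ^+ 2).
Proof.
move=> a0 b0 s0 s1 L0 k0; rewrite -!mulrDr => h1 h2.
have s1' : 0 <= 1 - s by rewrite subr_ge0.
have hab : 0 <= L * (a + b) by rewrite mulr_ge0 ?addr_ge0.
have h3 : D1 <= L * (a + b).
  by apply: le_trans h1 _; rewrite mulrCA ler_piMl // lerBlDr lerDl.
have h4 : D2 <= L * (a + b) by apply: le_trans h2 _; rewrite mulrCA ler_piMl.
have h5 := ler_wpM2r a0 h4; have h6 := ler_wpM2r b0 h3.
have ab := sqr_ge0 (a - b); rewrite sqrrB in ab.
have a2 := sqr_ge0 a; have b2 := sqr_ge0 b.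
have e0 : L * (a + b) * a + L * (a + b) * b = L * (a + b) ^+ 2 by ring.
have h7 : L * (a + b) ^+ 2 <= L * (2 * (a ^+ 2 + b ^+ 2)).
  by rewrite ler_wpM2l // sqrrD; lra.
have h8 : kappa * a ^+ 2 <= kappa * (2 * (a ^+ 2 + b ^+ 2)).
  by rewrite ler_wpM2l //; lra.
apply: le_trans (_ : 2 * (L + kappa) * (a ^+ 2 + b ^+ 2) <= _); first by lra.
by rewrite ler_wpM2r ?addr_ge0 //; lra.
Qed.

(** The scalar mean value theorem is applied to the component of f along the
    increment f b - f a itself. *)
Lemma vector_mvt_bound (R : realType) (d : nat) (f df : R -> 'rV[R]_d)
    (a b L : R) : a <= b ->
  (forall x, a < x < b -> is_derive x 1 f (df x)) ->
  {within `[a, b], continuous f} ->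
  (forall x, a < x < b -> enorm (df x) <= L) ->
  enorm (f b - f a) <= L * (b - a).
Proof.
move=> ab fd fc hL; set v := f b - f a.
have [/eqP v0|v0] := boolP (enorm v == 0).
  rewrite v0; move: ab; rewrite le_eqVlt => /predU1P[->|ab]; first by rewrite subrr mulr0.
  have L0 : 0 <= L.
    apply: le_trans (enorm_ge0 (df ((a + b) / 2))) (hL _ _).
    by rewrite !midf_lt.
  by apply: mulr_ge0 => //; rewrite subr_ge0 ltW.
have {}v0 : 0 < enorm v by rewrite lt_def v0 enorm_ge0.
rewrite -(ler_pM2l v0) -expr2 sqr_enorm.
have -> : dot v v = dot v (f b) - dot v (f a) by rewrite -dotBr.
apply: le_trans (ler_norm _) _; rewrite mulrA.
apply: (@mvt_bound R (fun x => dot v (f x)) (fun x => dot v (df x))) => //.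
- move=> x xab; apply: is_derive_eq (is_derive_dot (is_derive_cst v _ _) (fd x xab)) _.
  by rewrite dot0l add0r.
- by move=> x; apply: cvg_dot; [exact: cvg_cst|exact: fc].
move=> x xab; apply: le_trans (abs_dot_le _ _) _.
by rewrite ler_wpM2l ?hL ?enorm_ge0.
Qed.

Section Characteristics.
(* In the application [f t] is F(., sigma_t) and [g0] is g(., sigma_0). *)
Variables (R : realType) (d : nat).
Local Notation ph := ('rV[R]_d * 'rV[R]_d)%type.
Variables (H : 'rV[R]_d -> 'rV[R]_d -> R) (f : R -> 'rV[R]_d -> R)
  (g0 : 'rV[R]_d -> R) (T B L kappa : R) (Q P : R -> 'rV[R]_d -> 'rV[R]_d)
  (z : R -> 'rV[R]_d -> R) (K : R).

Hypothesis KE : K = 1 + L + kappa.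
Hypothesis L0 : 0 <= L.
Hypothesis kappa0 : 0 <= kappa.
Hypothesis T0 : 0 < T.
Hypothesis smallT : 16 * K ^+ 3 * T <= 1.
Hypothesis Hd : forall y, differentiable (fun y : ph => H y.1 y.2) y.
Hypothesis HL : forall q p q' p', enorm p <= B -> enorm p' <= B ->
   [/\ enorm (gradp H q p) <= L,
       enorm (gradq H q' p' - gradq H q p) <= L * (enorm (q' - q) + enorm (p' - p)) &
       enorm (gradp H q' p' - gradp H q p) <= L * (enorm (q' - q) + enorm (p' - p))].
Hypothesis fd : forall t x, differentiable (f t) x.
Hypothesis fL : forall t x y,
  enorm (grad (f t) x - grad (f t) y) <= kappa * enorm (x - y).
Hypothesis gd : forall x, differentiable g0 x.
Hypothesis gL : forall x y,
  enorm (grad g0 x - grad g0 y) <= kappa * enorm (x - y).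
Hypothesis cQ : forall q, {within `[0, T], continuous (Q ^~ q)}.
Hypothesis cP : forall q, {within `[0, T], continuous (P ^~ q)}.
Hypothesis PB : forall (t : R) q, 0 <= t <= T -> enorm (P t q) <= B.
Hypothesis dQ : forall (t : R) q, 0 < t < T ->
  is_derive t 1 (Q ^~ q) (gradp H (Q t q) (P t q)).
Hypothesis dP : forall (t : R) q, 0 < t < T ->
  is_derive t 1 (P ^~ q) (- gradq H (Q t q) (P t q) - grad (f t) (Q t q)).
Hypothesis P0 : forall q, P 0 q = grad g0 (Q 0 q).

Lemma K_ge1 : 1 <= K. Proof. by rewrite KE -addrA lerDl addr_ge0. Qed.
Lemma K_ge0 : 0 <= K. Proof. exact: le_trans ler01 K_ge1. Qed.

Lemma flow_speed q (t t' : R) : 0 <= t <= T -> 0 <= t' <= T ->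
  enorm (Q t' q - Q t q) <= L * `|t' - t|.
Proof.
wlog tt' : t t' / t <= t' => [hw tT t'T|].
  have [tt'|/ltW t't] := leP t t'; first exact: hw.
  by rewrite enormBC distrC; exact: hw.
move=> /andP[t0 tT] /andP[t'0 t'T]; rewrite ger0_norm ?subr_ge0 //.
have inT x : t < x < t' -> 0 < x < T.
  by move=> /andP[tx xt']; rewrite (le_lt_trans t0 tx) (lt_le_trans xt' t'T).
apply: (vector_mvt_bound (f := Q ^~ q) (df := fun x => gradp H (Q x q) (P x q))) => //.
- by move=> x /inT; exact: dQ.
- apply: continuous_subspaceW (cQ (q := q)) => x /=; rewrite !in_itv /=.
  by move=> /andP[tx xt']; rewrite (le_trans t0 tx) (le_trans xt' t'T).
move=> x /inT /andP[/ltW x0 /ltW xT].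
have xB : enorm (P x q) <= B by apply: PB; rewrite x0.
by have [] := HL (Q x q) (Q x q) xB xB.
Qed.

Section TwoTrajectories.
Variables q q' : 'rV[R]_d.
Let DQ t := Q t q' - Q t q.
Let DP t := P t q' - P t q.
Let n t := dot (DQ t) (DQ t) + dot (DP t) (DP t).
Let m t := dot (DQ t) (DQ t).

Let nE t : n t = enorm (DQ t) ^+ 2 + enorm (DP t) ^+ 2.
Proof. by rewrite !sqr_enorm. Qed.

Let mE t : m t = enorm (DQ t) ^+ 2.
Proof. by rewrite sqr_enorm. Qed.

Let m0 t : 0 <= m t. Proof. exact: dot_ge0. Qed.
Let n0 t : 0 <= n t. Proof. by rewrite addr_ge0 ?dot_ge0. Qed.

Let lt_le t : 0 < t < T -> 0 <= t <= T.
Proof. by move=> /andP[/ltW -> /ltW ->]. Qed.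

Let dm t := 2 * dot (DQ t)
  (gradp H (Q t q') (P t q') - gradp H (Q t q) (P t q)).

Let is_derive_m t : 0 < t < T -> is_derive t 1 m (dm t).
Proof.
move=> tT; have d1 := is_deriveB (dQ q' tT) (dQ q tT).
apply: is_derive_eq (is_derive_dot d1 d1) _.
by rewrite dotC /dm -/(DQ t) mulr_natl mulr2n.
Qed.

Let dn t := dm t + 2 * dot (DP t)
  ((- gradq H (Q t q') (P t q') - grad (f t) (Q t q')) -
   (- gradq H (Q t q) (P t q) - grad (f t) (Q t q))).

Let is_derive_n t : 0 < t < T -> is_derive t 1 n (dn t).
Proof.
move=> tT; have d1 := is_deriveB (dP q' tT) (dP q tT).
have d2 := is_derive_m tT.
apply: is_derive_eq (is_deriveD d2 (is_derive_dot d1 d1)) _.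
by rewrite [X in _ + (X + _)]dotC -/(DP t) /dn mulr_natl mulr2n.
Qed.

Let cDQ : {within `[0, T], continuous DQ}.
Proof. by move=> t; apply: cvgB; [exact: cQ|exact: cQ]. Qed.

Let cDP : {within `[0, T], continuous DP}.
Proof. by move=> t; apply: cvgB; [exact: cP|exact: cP]. Qed.

Let cm : {within `[0, T], continuous m}.
Proof. by move=> t; apply: cvg_dot; exact: cDQ. Qed.

Let cn : {within `[0, T], continuous n}.
Proof. by move=> t; apply: cvgD; [exact: cm|apply: cvg_dot; exact: cDP]. Qed.

Let dm_bound t : 0 < t < T -> `|dm t| <= 4 * K * n t.
Proof.
move=> tT; have tT' := lt_le tT.
rewrite /dm normrM (@ger0_norm _ 2) //.
have := abs_dot_le (DQ t) (gradp H (Q t q') (P t q') - gradp H (Q t q) (P t q)).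
have [_ _] := HL (Q t q) (Q t q') (PB q tT') (PB q' tT').
rewrite -/(DQ t) -/(DP t) nE.
have a0 := enorm_ge0 (DQ t); have b0 := enorm_ge0 (DP t).
move: (enorm (DQ t)) (enorm (DP t)) a0 b0 => a b a0 b0.
set D := enorm _ => h1 h2.
have h3 : a * D <= a * (L * (a + b)) by rewrite ler_wpM2l.
have LK : L <= K by rewrite KE; have := kappa0; lra.
have ab := sqr_ge0 (a - b); rewrite sqrrB in ab.
have a2 := sqr_ge0 a; have b2 := sqr_ge0 b.
have h4 : L * (a ^+ 2 + a * b) <= L * (2 * (a ^+ 2 + b ^+ 2)).
  by rewrite ler_wpM2l //; lra.
have h5 : L * (2 * (a ^+ 2 + b ^+ 2)) <= K * (2 * (a ^+ 2 + b ^+ 2)).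
  by rewrite ler_wpM2r //; lra.
have e0 : a * (L * (a + b)) = L * (a ^+ 2 + a * b) by ring.
by rewrite e0 in h3; lra.
Qed.

Let dn_bound t : 0 < t < T -> `|dn t| <= 8 * K * n t.
Proof.
move=> tT; have tT' := lt_le tT.
apply: le_trans (ler_normD _ _) _.
have -> : 8 * K * n t = 4 * K * n t + 4 * K * n t by ring.
apply: lerD; first exact: dm_bound.
rewrite normrM (@ger0_norm _ 2) //.
set v := _ - _ - _.
have -> : v = - ((gradq H (Q t q') (P t q') - gradq H (Q t q) (P t q)) +
    (grad (f t) (Q t q') - grad (f t) (Q t q))).
  by rewrite /v; apply/rowP => i; rewrite !mxE; ring.
rewrite dotNr normrN; apply: le_trans (ler_wpM2l _ (abs_dot_le _ _)) _ => //.
have [_ h1 _] := HL (Q t q) (Q t q') (PB q tT') (PB q' tT').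
have h2 := fL t (Q t q') (Q t q).
have := le_trans (enormD _ _) (lerD h1 h2); move: h1 h2 => _ _.
rewrite -/(DQ t) -/(DP t) nE.
have a0 := enorm_ge0 (DQ t); have b0 := enorm_ge0 (DP t).
move: (enorm (DQ t)) (enorm (DP t)) a0 b0 => a b a0 b0.
set D := enorm _ => h1.
have ab := sqr_ge0 (a - b); rewrite sqrrB in ab.
have a2 := sqr_ge0 a; have b2 := sqr_ge0 b.
have h3 := ler_wpM2l b0 h1.
have h4 : L * (a * b + b ^+ 2) <= L * (2 * (a ^+ 2 + b ^+ 2)).
  by rewrite ler_wpM2l //; lra.
have h5 : kappa * (a * b) <= kappa * (2 * (a ^+ 2 + b ^+ 2)).
  by rewrite ler_wpM2l //; lra.
have e0 : b * (L * (a + b) + kappa * a) = L * (a * b + b ^+ 2) + kappa * (a * b) by ring.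
rewrite e0 in h3; apply: le_trans (_ : 4 * (L + kappa) * (a ^+ 2 + b ^+ 2) <= _).
  by lra.
by rewrite ler_wpM2r ?addr_ge0 // KE; lra.
Qed.

Let small t : 0 <= t <= T -> 16 * K ^+ 3 * t <= 1.
Proof.
move=> /andP[t0 tT]; apply: le_trans smallT.
by rewrite ler_wpM2l // mulr_ge0 // exprn_ge0 // K_ge0.
Qed.

Let small1 t : 0 <= t <= T -> 16 * K * t <= 1.
Proof.
move=> tT; apply: le_trans (small tT).
have /andP[t0 _] := tT; rewrite ler_wpM2r // ler_wpM2l //.
by rewrite -[leLHS]expr1 ler_weXn2l // K_ge1.
Qed.

Let subcont (h : R -> R) t : 0 <= t <= T ->
  {within `[0, T], continuous h} -> {within `[0, t], continuous h}.
Proof.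
move=> /andP[t0 tT]; apply: continuous_subspaceW => x /=.
by rewrite !in_itv /= => /andP[-> /le_trans ->].
Qed.

(** At a time c where n is maximal, the mean value theorem gives
    n c - n 0 <= 8 K c n(c), and the smallness of T makes this at most n(c) / 2. *)
Let phase_distance_le_initial t : 0 <= t <= T -> n t <= 2 * n 0.
Proof.
move=> tT; have [c] := EVT_max (ltW T0) cn; rewrite in_itv /= => cT hmax.
have {hmax}hmax x : 0 <= x <= T -> n x <= n c.
  by move=> xT; apply: hmax; rewrite in_itv.
apply: le_trans (hmax t tT) _; have [c0 cT'] := andP cT.
have : `|n c - n 0| <= 8 * K * n c * (c - 0).
  apply: (@mvt_bound R n dn) => //.
  - by move=> x /andP[x0 xc]; apply: is_derive_n; rewrite x0 (lt_le_trans xc).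
  - exact: subcont cn.
  move=> x /andP[x0 xc]; have xT : 0 < x < T by rewrite x0 (lt_le_trans xc).
  apply: le_trans (dn_bound xT) _; apply: ler_wpM2l (hmax _ (lt_le xT)).
  by rewrite mulr_ge0 // K_ge0.
rewrite subr0 => /ler_normlP[_]; have := ler_wpM2r (n0 c) (small1 cT).
by have := n0 c; lra.
Qed.

Let n0_le : n 0 <= K ^+ 2 * m 0.
Proof.
rewrite nE mE /DP !P0.
have h := gL (Q 0 q') (Q 0 q); have a0 := enorm_ge0 (DQ 0).
have h2 : enorm (grad g0 (Q 0 q') - grad g0 (Q 0 q)) ^+ 2 <=
    (kappa * enorm (DQ 0)) ^+ 2.
  by rewrite ler_sqr ?nnegrE ?mulr_ge0 ?enorm_ge0.
apply: le_trans (lerD (lexx _) h2) _.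
rewrite exprMn -{1}[enorm _ ^+ 2]mul1r -mulrDl ler_wpM2r ?sqr_ge0 //.
by rewrite KE; have l0 := L0; have k0 := kappa0; nra.
Qed.

Let n_le_m0 t : 0 <= t <= T -> n t <= 2 * K ^+ 2 * m 0.
Proof.
move=> tT; apply: le_trans (phase_distance_le_initial tT) _.
by rewrite -mulrA ler_wpM2l // n0_le.
Qed.

Let m0_le t : 0 <= t <= T -> m 0 <= 2 * m t.
Proof.
move=> tT; have [t0 tT'] := andP tT.
have : `|m t - m 0| <= 8 * K ^+ 3 * m 0 * (t - 0).
  apply: (@mvt_bound R m dm) => //.
  - by move=> x /andP[x0 xc]; apply: is_derive_m; rewrite x0 (lt_le_trans xc).
  - exact: subcont cm.
  move=> x /andP[x0 xc]; have xT : 0 < x < T by rewrite x0 (lt_le_trans xc).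
  apply: le_trans (dm_bound xT) _.
  have -> : 8 * K ^+ 3 * m 0 = 4 * K * (2 * K ^+ 2 * m 0) by ring.
  by rewrite ler_wpM2l ?mulr_ge0 ?K_ge0 // n_le_m0 // lt_le.
rewrite subr0 => /ler_normlP[h _]; have := ler_wpM2r (m0 0) (small tT).
by have := m0 0; lra.
Qed.

Let n_le_m t u : 0 <= t <= T -> 0 <= u <= T ->
  n u <= 4 * K ^+ 2 * m t.
Proof.
move=> tT uT; apply: le_trans (n_le_m0 uT) _.
have -> : 4 * K ^+ 2 * m t = 2 * K ^+ 2 * (2 * m t) by ring.
by rewrite ler_wpM2l ?m0_le // mulr_ge0 // sqr_ge0.
Qed.

(** The estimate holds in both directions of time: n is controlled by its
    initial value, this by m(0) because the initial momentum is a Lipschitz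
    function of the initial position, and m(0) by m(t) because m varies little
    over a short time.  If the flow is the identity at time s, then t = s says
    that it is Lipschitz in the label, u = s that it is injective with Lipschitz
    inverse, and u = t that the momentum is a Lipschitz function of the position. *)
Lemma flow_lipschitz t u : 0 <= t <= T -> 0 <= u <= T ->
  enorm (Q u q' - Q u q) ^+ 2 + enorm (P u q' - P u q) ^+ 2 <=
  4 * K ^+ 2 * enorm (Q t q' - Q t q) ^+ 2.
Proof. by move=> tT uT; rewrite -/(DQ _) -/(DP _) -nE -mE; exact: n_le_m. Qed.

Hypothesis cz : forall q, {within `[0, T[, continuous (z ^~ q)}.
Hypothesis dz : forall (t : R) q, 0 < t < T -> is_derive t 1 (z ^~ q)
  (dot (P t q) (gradp H (Q t q) (P t q)) - H (Q t q) (P t q) - f t (Q t q)).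
Hypothesis z0 : forall q, z 0 q = g0 (Q 0 q).

Let D t := z t q' - z t q - dot (P t q) (DQ t).

Let dD t :=
  (dot (P t q') (gradp H (Q t q') (P t q')) - H (Q t q') (P t q') - f t (Q t q')) -
  (dot (P t q) (gradp H (Q t q) (P t q)) - H (Q t q) (P t q) - f t (Q t q)) -
  (dot (- gradq H (Q t q) (P t q) - grad (f t) (Q t q)) (DQ t) +
   dot (P t q) (gradp H (Q t q') (P t q') - gradp H (Q t q) (P t q))).

Let is_derive_D t : 0 < t < T -> is_derive t 1 D (dD t).
Proof.
move=> tT; have d1 := is_deriveB (dQ q' tT) (dQ q tT).
exact: is_deriveB (is_deriveB (dz q' tT) (dz q tT)) (is_derive_dot (dP q tT) d1).
Qed.

Let cD t : 0 <= t < T -> {within `[0, t], continuous D}.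
Proof.
move=> /andP[t0 tT] x.
have cz' y : {within `[0, t], continuous (z ^~ y)}.
  apply: continuous_subspaceW (cz (q := y)) => {}x /=; rewrite !in_itv /= => /andP[-> /=].
  by move/le_lt_trans; apply.
have cP' : {within `[0, t], continuous (P ^~ q)}.
  apply: continuous_subspaceW (cP (q := q)) => {}x /=; rewrite !in_itv /= => /andP[-> /=].
  by move/le_trans; apply; exact: ltW.
have cDQ' : {within `[0, t], continuous DQ}.
  apply: continuous_subspaceW cDQ => {}x /=; rewrite !in_itv /= => /andP[-> /=].
  by move/le_trans; apply; exact: ltW.
apply: cvgB; first by apply: cvgB; exact: cz'.
by apply: cvg_dot; [exact: cP'|exact: cDQ'].
Qed.

Let dD_bound t : 0 < t < T -> `|dD t| <= 2 * K * n t.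
Proof.
move=> tT; have tT' := lt_le tT; pose Hz := fun y : ph => H y.1 y.2.
have [s /andP[s0 s1]] := mvt_segment (Q t q, P t q) (Q t q', P t q') Hd.
set y := _ + s *: _ => hy.
have y1 : y.1 = Q t q + s *: DQ t by [].
have y2 : y.2 = P t q + s *: DP t by [].
have yB : enorm y.2 <= B.
  have -> : y.2 = (1 - s) *: P t q + s *: P t q'.
    by rewrite y2 scalerBr scalerBl scale1r addrAC addrA.
  apply: le_trans (enormD _ _) _; rewrite !enormZ !ger0_norm ?subr_ge0 //.
  have -> : B = (1 - s) * B + s * B by ring.
  by apply: lerD; apply: ler_wpM2l; rewrite ?subr_ge0 // PB.
have {}hy : H (Q t q') (P t q') - H (Q t q) (P t q) =
    dot (gradq H y.1 y.2) (DQ t) + dot (gradp H y.1 y.2) (DP t).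
  rewrite gradqE gradpE; move: hy; rewrite /= => ->.
  by rewrite [X in derive _ _ X]surjective_pairing derive_pair //; case: (y).
have -> : dD t = dot (gradp H (Q t q') (P t q') - gradp H y.1 y.2) (DP t) +
    dot (gradq H (Q t q) (P t q) - gradq H y.1 y.2) (DQ t) -
    (f t (Q t q') - f t (Q t q) - dot (grad (f t) (Q t q)) (DQ t)).
  exact: action_defect_identity hy.
have hf := taylor_grad (fd t) (fL t) (Q t q) (Q t q').
have [_ _] := HL y.1 (Q t q') yB (PB q' tT').
have -> : Q t q' - y.1 = (1 - s) *: DQ t.
  by rewrite y1 scalerBl scale1r opprD addrA.
have -> : P t q' - y.2 = (1 - s) *: DP t.
  by rewrite y2 scalerBl scale1r opprD addrA.
have [_] := HL y.1 (Q t q) yB (PB q tT').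
have -> : Q t q - y.1 = - (s *: DQ t) by rewrite y1 opprD addNKr.
have -> : P t q - y.2 = - (s *: DP t) by rewrite y2 opprD addNKr.
have s1' : 0 <= 1 - s by rewrite subr_ge0.
rewrite !enormN !enormZ (ger0_norm s0) (ger0_norm s1') => h1 _ h2.
apply: le_trans (ler_normB _ _) _; apply: le_trans (lerD (ler_normD _ _) hf) _.
have h3 := abs_dot_le (gradp H (Q t q') (P t q') - gradp H y.1 y.2) (DP t).
have h4 := abs_dot_le (gradq H (Q t q) (P t q) - gradq H y.1 y.2) (DQ t).
apply: le_trans (lerD (lerD h3 h4) (lexx _)) _; rewrite nE KE.
by apply: action_defect_bound h2 h1 => //; exact: enorm_ge0.
Qed.

(** The value z is differentiable as a function of the position Q(t,q), with
    gradient P(t,q), and the remainder is quadratic with a constant independent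
    of t, q and q'. *)
Lemma action_taylor t : 0 <= t < T ->
  `|z t q' - z t q - dot (P t q) (Q t q' - Q t q)| <=
  5 * K ^+ 3 * enorm (Q t q' - Q t q) ^+ 2.
Proof.
move=> tT; have [t0 tT'] := andP tT.
have tT2 : 0 <= t <= T by rewrite t0 ltW.
have z02 : 0 <= (0 : R) <= T by rewrite lexx ltW.
have h0 : `|D 0| <= K * (4 * K ^+ 2 * m t).
  rewrite /D !z0 P0; apply: le_trans (taylor_grad gd gL _ _) _.
  have kK : kappa <= K by rewrite KE; have := L0; lra.
  apply: ler_pM => //; first exact: sqr_ge0.
  apply: le_trans (n_le_m tT2 z02).
  by rewrite nE lerDl sqr_ge0.
have h1 : `|D t - D 0| <= 2 * K * (4 * K ^+ 2 * m t) * (t - 0).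
  apply: (@mvt_bound R D dD) => //.
  - by move=> x /andP[x0 xt]; apply: is_derive_D; rewrite x0 (lt_trans xt).
  - exact: cD.
  move=> x /andP[x0 xt]; have xT : 0 < x < T by rewrite x0 (lt_trans xt).
  apply: le_trans (dD_bound xT) _; rewrite ler_wpM2l ?mulr_ge0 ?K_ge0 //.
  exact: n_le_m tT2 (lt_le xT).
rewrite -/(DQ t) -mE -/(D t).
have -> : D t = D 0 + (D t - D 0) by rewrite addrC subrK.
apply: le_trans (ler_normD _ _) _; apply: le_trans (lerD h0 h1) _.
rewrite subr0; have := ler_wpM2r (m0 t) (small tT2).
have K1 : 1 <= K ^+ 3 by rewrite exprn_ege1 // K_ge1.
have := ler_wpM2r (m0 t) K1; have := m0 t; move: (m t) => y y0 h1' h2'.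
have e1 : K * (4 * K ^+ 2 * y) = 4 * (K ^+ 3 * y) by ring.
have e2 : 2 * K * (4 * K ^+ 2 * y) * t = 8 * (K ^+ 3 * t * y) by ring.
have e3 : 16 * K ^+ 3 * t * y = 16 * (K ^+ 3 * t * y) by ring.
by rewrite e1 e2; rewrite e3 in h2'; lra.
Qed.

End TwoTrajectories.

End Characteristics.

(** * Regularity of the value function *)

Lemma integer_valued_continuous (R : realType) (f : R -> R) (T : R) :
  {within `[0, T], continuous f} ->
  (forall t, 0 <= t <= T -> f t \is a Num.int) ->
  forall s t, 0 <= s <= T -> 0 <= t <= T -> f s = f t.
Proof.
move=> cf fint.
suff mono s t : 0 <= s <= T -> 0 <= t <= T -> s <= t -> f s = f t.
  move=> s t hs ht; have [st|/ltW ts] := leP s t; first exact: mono.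
  by symmetry; exact: mono.
move=> hs ht st; apply/eqP; apply: contraT => fst.
set lo := Num.min (f s) (f t).
have hi : lo + 1 <= Num.max (f s) (f t).
  have h1 : 1 <= `|f s - f t|.
    by apply: norm_intr_ge1; [rewrite rpredB ?fint|rewrite subr_eq0].
  rewrite /lo; case: (ltgtP (f s) (f t)) h1 fst => // h h1 _.
    by rewrite ltr0_norm ?subr_lt0 // opprB lerBrDl in h1.
  by rewrite gtr0_norm ?subr_gt0 // lerBrDl in h1.
have cf' : {within `[s, t], continuous f}.
  apply: continuous_subspaceW cf => x /=; rewrite !in_itv /= => /andP[sx xt].
  have /andP[s0 _] := hs; have /andP[_ tT] := ht.
  by rewrite (le_trans s0 sx) (le_trans xt tT).
(* Two distinct integers have a non-integer, at distance 1/2 from the smaller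
   one, between them. *)
have hv : Num.min (f s) (f t) <= lo + 2^-1 <= Num.max (f s) (f t).
  rewrite lerDl invr_ge0 ler0n /=; apply: le_trans hi.
  by rewrite lerD2l invf_le1 // ler1n.
have [c cst fc] := IVT st cf' hv.
have cT : 0 <= c <= T.
  move: cst; rewrite in_itv /= => /andP[sc ct].
  have /andP[s0 _] := hs; have /andP[_ tT] := ht.
  by rewrite (le_trans s0 sc) (le_trans ct tT).
have lint : lo \is a Num.int by rewrite /lo minEle; case: ifP => _; exact: fint.
have : (2^-1 : R) \is a Num.int.
  by rewrite -[2^-1](addKr lo) -fc addrC rpredB // fint.
move/norm_intr_ge1; rewrite invr_eq0 pnatr_eq0 /= => /(_ isT).
by rewrite ger0_norm ?invr_ge0 // invf_ge1 // lern1.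
Qed.

Section JointDifferentiability.
Variables (R : realType).

Lemma differentiable_quadratic (V : normedModType R) (r : V -> R) x (C : R) :
  (\forall y \near x, `|r y| <= C * `|y - x| ^+ 2) ->
  differentiable r x /\ forall v, derive r x v = 0.
Proof.
move=> rq.
have C0 : 0 <= `|C| + 1 by rewrite addr_ge0.
have r0 : r x = 0.
  apply/eqP; rewrite -normr_le0; apply: le_trans (nbhs_singleton rq) _.
  by rewrite subrr normr0 expr2 !mulr0.
have ro : r \o shift x = cst (r x) + (0 : V -> R) +o_ (nbhs (0 : V)) id.
  apply/eqaddoP => e e0; rewrite r0.
  move: rq; rewrite (near_shift 0) /= subr0 => rq.
  have ball0 : \forall h \near (0 : V), `|h| < e / (`|C| + 1).
    by apply/nbhs0_lt; rewrite divr_gt0 // ltr_pwDr.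
  near=> h.
  have rh : `|r (h + x)| <= C * `|h| ^+ 2 by have := near rq h; rewrite /= addrK; exact.
  have hh : `|h| < e / (`|C| + 1) by near: h.
  rewrite !fctE /= !addr0 subr0.
  apply: le_trans rh _; apply: le_trans (_ : (`|C| + 1) * `|h| ^+ 2 <= _).
    by rewrite ler_wpM2r ?sqr_ge0 // ler_wpDr // ler_norm.
  rewrite expr2 mulrA ler_wpM2r // mulrC -ler_pdivlMr ?ltr_pwDr //.
  exact: ltW.
have rd0 : 'd r x = (0 : V -> R) :> (V -> R).
  apply: diff_unique => //; exact: cst_continuous.
have rd : differentiable r x.
  by apply/diff_locallyP; split; rewrite rd0 //; exact: cst_continuous.
by split=> // v; rewrite deriveE // rd0.
Unshelve. all: by end_near. Qed.

End JointDifferentiability.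

Lemma squeeze0 (R : realType) (T : Type) (G : set_system T) {FG : Filter G}
    (k h : T -> R) :
  (\forall x \near G, 0 <= k x <= h x) -> h x @[x --> G] --> (0 : R) ->
  k x @[x --> G] --> (0 : R).
Proof.
move=> kh h0.
have c0 : (fun=> 0 : R) x @[x --> G] --> (0 : R) by exact: cvg_cst.
exact: (squeeze_cvgr (f := fun=> 0) kh c0 h0).
Qed.

Section ComponentDerivatives.
Variables (R : realType) (W V : normedModType R).

Lemma is_derive_time_component (f : R -> W) f' (w : R * V) a b :
  is_derive w.1 1 f f' -> is_derive w (a, b) (fun w => f w.1) (a *: f').
Proof.
move=> fd; have gE h : (h *: (a, b) + w).1 = h *: a + w.1 by [].
have fdiff : differentiable f w.1 by apply/derivable1_diffP; have [] := fd.
have [h1 h2] := derive_affine_comp f (g := fst) gE.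
apply: DeriveDef; first by apply/h1; exact: diff_derivable.
have <- : derive f w.1 1 = f' by exact: derive_val.
rewrite h2 !deriveE // -linearZ; congr ('d f (w.1) _).
by rewrite /GRing.scale /= mulr1.
Qed.

Lemma is_derive_space_component (w : R * V) a b :
  is_derive w (a, b) (fun w => w.2) b.
Proof.
have gE h : (h *: (a, b) + w).2 = h *: b + w.2 by [].
have [h1 h2] := derive_affine_comp (fun v : V => v) (g := snd) gE.
apply: DeriveDef; first by apply/h1; exact: derivable_id.
by rewrite h2 derive_id.
Qed.

Lemma differentiable_time_component (f : R -> W) f' (w : R * V) :
  is_derive w.1 1 f f' -> differentiable (fun w : R * V => f w.1) w.
Proof.
move=> fd; apply: (@differentiable_comp _ _ _ _ fst f).
  by apply: linear_differentiable => y; exact: cvg_fst.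
by apply/derivable1_diffP; have [] := fd.
Qed.

End ComponentDerivatives.

Section ValueFunction.
Variables (R : realType) (d : nat).
Local Notation sp := (R * 'rV[R]_d)%type.
Variables (H : 'rV[R]_d -> 'rV[R]_d -> R) (f : R -> 'rV[R]_d -> R)
  (T L C C' : R) (Q P P' Y : R -> 'rV[R]_d -> 'rV[R]_d)
  (z U : R -> 'rV[R]_d -> R).
Hypothesis L0 : 0 <= L.
Hypothesis speed : forall q (t t' : R), 0 < t < T -> 0 < t' < T ->
  enorm (Q t' q - Q t q) <= L * `|t' - t|.
Hypothesis dQ : forall (t : R) q, 0 < t < T ->
  is_derive t 1 (Q ^~ q) (gradp H (Q t q) (P t q)).
Hypothesis dP : forall (t : R) q, 0 < t < T ->
  is_derive t 1 (P ^~ q) (P' t q).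
Hypothesis dz : forall (t : R) q, 0 < t < T -> is_derive t 1 (z ^~ q)
  (dot (P t q) (gradp H (Q t q) (P t q)) - H (Q t q) (P t q) - f t (Q t q)).
Hypothesis QY : forall (t : R) x, 0 < t < T -> Q t (Y t x) = x.
Hypothesis UE : forall (t : R) x, 0 < t < T -> U t x = z t (Y t x).
Hypothesis lipP : forall (t : R) q q', 0 < t < T ->
  enorm (P t q' - P t q) ^+ 2 <= C * enorm (Q t q' - Q t q) ^+ 2.
Hypothesis taylor : forall (t : R) q q', 0 < t < T ->
  `|z t q' - z t q - dot (P t q) (Q t q' - Q t q)| <=
  C' * enorm (Q t q' - Q t q) ^+ 2.
Hypothesis cH : continuous (fun y : 'rV[R]_d * 'rV[R]_d => H y.1 y.2).
Hypothesis cf : forall w : sp, 0 < w.1 < T ->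
  {for w, continuous (fun w : sp => f w.1 w.2)}.

Lemma near_time (w : sp) : 0 < w.1 < T -> \forall y \near w, 0 < (y : sp).1 < T.
Proof.
move=> wT.
have : \forall t \near w.1, 0 < t < T.
  have wT' : w.1 \in `]0, T[ by rewrite in_itv.
  by have := near_in_itvoo wT'; apply: filterS => t; rewrite in_itv.
move=> h; have := @cvg_fst _ _ (nbhs w.1) (nbhs w.2) _ _ h.
exact.
Qed.

(** Along the trajectory through the base point the momentum is continuous in
    time, and at a fixed time [lipP] compares neighbouring trajectories through
    their positions. *)
Lemma transported_momentum_continuous w : 0 < w.1 < T ->
  {for w, continuous (fun w : sp => P w.1 (Y w.1 w.2))}.
Proof.
move=> wT; set q := Y w.1 w.2.
have cQq : {for w, continuous (fun w : sp => Q w.1 q)}.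
  exact: differentiable_continuous (differentiable_time_component (dQ q wT)).
have dPq := dP q wT.
have cPq : {for w, continuous (fun w : sp => P w.1 q)}.
  exact: differentiable_continuous
    (differentiable_time_component dPq).
apply: cvg_enorm0P.
have h1 : enorm (P y.1 q - P w.1 q) @[y --> w] --> (0 : R).
  rewrite -(enorm0 R d) -(subrr (P w.1 q)); apply: cvg_enorm.
  by apply: cvgB; [exact: cPq|exact: cvg_cst].
have h2 : Num.sqrt (C * enorm (y.2 - Q y.1 q) ^+ 2) @[y --> w] --> (0 : R).
  rewrite -(sqrtr0 R); apply: continuous_cvg; first exact: sqrt_continuous.
  have -> : 0 = C * enorm (w.2 - Q w.1 q) ^+ 2 :> R.
    by rewrite QY // subrr enorm0 expr0n mulr0.
  apply: cvgM; first exact: cvg_cst.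
  rewrite expr2; under eq_fun do rewrite expr2.
  have h : enorm (y.2 - Q y.1 q) @[y --> w] --> enorm (w.2 - Q w.1 q).
    by apply: cvg_enorm; apply: cvgB; [exact: cvg_snd|exact: cQq].
  exact: cvgM.
have h3 : Num.sqrt (C * enorm (y.2 - Q y.1 q) ^+ 2) +
    enorm (P y.1 q - P w.1 q) @[y --> nbhs w] --> (0 : R).
  by rewrite -[X in _ --> X]addr0; exact: cvgD.
apply: squeeze0 h3.
near=> y; rewrite enorm_ge0 /=.
have yT : 0 < y.1 < T by near: y; exact: near_time.
rewrite -[X in enorm X](subrKA (P y.1 q)).
apply: le_trans (enormD _ _) _; rewrite lerD2r.
rewrite -[leLHS]ger0_norm ?enorm_ge0 // -sqrtr_sqr ler_wsqrtr //.
by apply: le_trans (lipP _ _ yT) _; rewrite QY.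
Unshelve. all: by end_near. Qed.

(** U is compared with G, its first order expansion in space around the position
    Q(t,q) of the one trajectory that passes through the base point.  G is
    differentiable in (t,x), and the remainder is quadratic because that
    trajectory has speed at most L. *)
Lemma value_differentiable w a b : 0 < w.1 < T ->
  differentiable (fun w : sp => U w.1 w.2) w /\
  derive (fun w : sp => U w.1 w.2) w (a, b) =
  dot (P w.1 (Y w.1 w.2)) b -
  a * (H w.2 (P w.1 (Y w.1 w.2)) + f w.1 w.2).
Proof.
move=> wT; set q := Y w.1 w.2.
have Qq : Q w.1 q = w.2 by exact: QY.
pose G := (fun y : sp => z y.1 q) + (fun y : sp => dot (P y.1 q) (y.2 - Q y.1 q)).
pose r := (fun y : sp => U y.1 y.2) - G.
have UGr : (fun y : sp => U y.1 y.2) = G + r by rewrite addrC subrK.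
have dQw : differentiable (fun y : sp => Q y.1 q) w.
  exact: differentiable_time_component (dQ q wT).
have dPq := dP q wT.
have dPw : differentiable (fun y : sp => P y.1 q) w.
  exact: differentiable_time_component dPq.
have dzw : differentiable (fun y : sp => z y.1 q) w.
  exact: differentiable_time_component (dz q wT).
have d2 : differentiable (fun y : sp => y.2) w.
  by apply: (@linear_differentiable _ _ _ snd) => y; exact: cvg_snd.
have Gd : differentiable G w.
  apply: differentiableD => //; apply: differentiable_dot => //.
  exact: differentiableB.
have Gder : is_derive w (a, b) G
   (dot (P w.1 q) b - a * (H w.2 (P w.1 q) + f w.1 w.2)).
  have e1 := @is_derive_time_component _ _ _ _ _ w a b (dz q wT).
  have e2 := @is_derive_time_component _ _ _ _ _ w a b dPq.
  have e3 := @is_derive_time_component _ _ _ _ _ w a b (dQ q wT).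
  have e4 := @is_derive_space_component R _ w a b.
  apply: is_derive_eq (is_deriveD e1 (is_derive_dot e2 (is_deriveB e4 e3))) _.
  rewrite !fctE /= Qq subrr dotBr [dot _ 0]dotC dot0l add0r dotZr /GRing.scale /=; ring.
have [] := @differentiable_quadratic R _ r w (`|C'| * (d%:R + L) ^+ 2).
  near=> y.
  have yT : 0 < y.1 < T by near: y; exact: near_time.
  have -> : r y = z y.1 (Y y.1 y.2) - z y.1 q -
      dot (P y.1 q) (Q y.1 (Y y.1 y.2) - Q y.1 q).
    by rewrite /r /G !fctE /= UE // QY // opprD addrA.
  apply: le_trans (taylor _ _ yT) _; rewrite QY //.
  apply: le_trans (_ : `|C'| * enorm (y.2 - Q y.1 q) ^+ 2 <= _).
    by rewrite ler_wpM2r ?sqr_ge0 ?ler_norm.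
  rewrite -mulrA -exprMn ler_wpM2l // ler_sqr ?nnegrE ?enorm_ge0 //; last first.
    by rewrite mulr_ge0 // addr_ge0.
  have -> : y.2 - Q y.1 q = (y - w).2 - (Q y.1 q - Q w.1 q).
    by rewrite Qq opprB addrA subrK.
  apply: le_trans (enormD _ _) _; rewrite enormN mulrDl; apply: lerD.
    apply: le_trans (enorm_le_norm _) _; rewrite ler_wpM2l //.
    by rewrite [leRHS]prod_normE le_max lexx orbT.
  apply: le_trans (speed q wT yT) _; rewrite ler_wpM2l //.
  by rewrite [leRHS]prod_normE le_max lexx.
move=> rd rder; split; first by rewrite UGr; exact: differentiableD.
rewrite UGr deriveD; last 2 first.
- by have [] := Gder.
- exact: diff_derivable.
by rewrite rder addr0; exact: derive_val.
Unshelve. all: by end_near. Qed.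


Lemma value_grad t x : 0 < t < T -> grad (U t) x = P t (Y t x).
Proof.
move=> tT; apply/rowP => i; rewrite mxE; set e := ebase R i.
rewrite (derive_space (fun w : sp => U w.1 w.2)).
have [_ ->] := @value_differentiable (t, x) 0 e tT.
rewrite mul0r subr0 /= /dot (bigD1 i) //= !mxE !eqxx mulr1 big1 ?addr0 //.
by move=> j ji; rewrite !mxE (negbTE ji) andbF mulr0.
Qed.

Lemma value_dt t x : 0 < t < T ->
  derive (U ^~ x) t 1 = - (H x (P t (Y t x)) + f t x).
Proof.
move=> tT; rewrite (derive_time (fun w : sp => U w.1 w.2)).
have [_ ->] := @value_differentiable (t, x) 1 0 tT.
by rewrite dotC dot0l sub0r mul1r.
Qed.

Lemma value_C1 : classC 1 [set w : sp | 0 < w.1 < T] (fun w => U w.1 w.2).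
Proof.
split=> [w wT|[a b] w wT]; first by have [] := value_differentiable 0 0 wT.
have cP := transported_momentum_continuous wT.
have e1 : \forall y \near w, dot (P y.1 (Y y.1 y.2)) b -
    a * (H y.2 (P y.1 (Y y.1 y.2)) + f y.1 y.2) =
    derive (fun w : sp => U w.1 w.2) y (a, b).
  have := near_time wT; apply: filterS => y yT.
  by have [_ ->] := value_differentiable a b yT.
have e2 := nbhs_singleton e1.
rewrite /prop_for /continuous_at -e2; apply: cvg_trans (near_eq_cvg e1) _.
apply: cvgB; first by apply: cvg_dot; [exact: cP|exact: cvg_cst].
apply: cvgM; first exact: cvg_cst.
apply: cvgD; last exact: cf.
have cp : (y.2, P y.1 (Y y.1 y.2)) @[y --> w] --> (w.2, P w.1 (Y w.1 w.2)).
  exact: (cvg_pair (cvg_snd (F := nbhs w.1) (G := nbhs w.2)) cP).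
have := continuous_cvg _ (@cH (w.2, P w.1 (Y w.1 w.2))) cp.
exact.
Qed.

End ValueFunction.

(** * Push-forwards and the Wasserstein distance *)

Section Pushforward.
Variables (R : realType) (d : nat).
Local Notation bV := (borel_rV R d).
Implicit Types (mu nu : prob2 R d) (f : 'rV[R]_d -> 'rV[R]_d).

Lemma continuous_measurable_rV f :
  continuous f -> measurable_fun setT (f : bV -> bV).
Proof.
move=> cf; apply: (@measurability _ _ bV bV setT f (@open 'rV[R]_d)) => //.
move=> _ [A oA <-]; rewrite setTI.
by apply: sub_sigma_algebra; exact: open_comp.
Qed.

Lemma continuous_measurable_real (h : 'rV[R]_d -> R) :
  continuous h -> measurable_fun setT (h : bV -> R).
Proof.
move=> ch; apply: (measurability _ (RGenOpens.measurableE R)).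
move=> _ [_ [a [b ->]] <-]; rewrite setTI.
by apply: sub_sigma_algebra; apply: open_comp => //; exact: interval_open.
Qed.

Lemma sqr_enorm_measurable :
  measurable_fun setT (fun x : bV => (enorm (x : 'rV[R]_d) ^+ 2)%:E).
Proof.
apply/measurable_EFinP.
apply: (continuous_measurable_real (h := fun x => enorm x ^+ 2)).
have -> : (fun x : 'rV[R]_d => enorm x ^+ 2) = (fun x => dot x x).
  by apply/funext => x; rewrite sqr_enorm.
by move=> x; exact: (@cvg_dot R d _ (nbhs x) _ id id x x cvg_id cvg_id).
Qed.

(** A map with bounded displacement preserves finiteness of the second moment, so
    the image measure is an element of P_2 and [push] returns it. *)
Lemma push_measurable_spec mu f c : measurable_fun setT (f : bV -> bV) ->
  (forall q, enorm (f q - q) <= c) ->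
  forall A : set bV, measurable A -> push f mu A = mu (f @^-1` A).
Proof.
move=> mf fc.
pose F : {mfun bV >-> bV} := mfun_Sub (mem_set mf).
have mom : (\int[distribution mu F]_x ((enorm (x : 'rV[R]_d) ^+ 2)%:E) < +oo)%E.
  rewrite (ge0_integral_pushforward mf) //=; last 2 first.
  - exact: sqr_enorm_measurable.
  - by move=> x _; rewrite lee_fin sqr_ge0.
  rewrite preimage_setT.
  have mg : measurable_fun setT
      (fun x : bV => ((2%:E * (enorm (x : 'rV[R]_d) ^+ 2)%:E) + (2 * c ^+ 2)%:E)%E).
    apply: emeasurable_funD => //.
    by apply: emeasurable_funM => //; exact: sqr_enorm_measurable.
  apply: (@le_lt_trans _ _
      (\int[mu]_x (2%:E * (enorm (x : 'rV[R]_d) ^+ 2)%:E + (2 * c ^+ 2)%:E))%E).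
    apply: ge0_le_integral => //.
    - by move=> x _; rewrite lee_fin sqr_ge0.
    - exact: (measurableT_comp sqr_enorm_measurable mf).
    move=> x _ /=; rewrite -EFinM -EFinD lee_fin.
    have h := enormD (f x - x) x; rewrite subrK in h.
    have h2 := fc x; have e1 := enorm_ge0 (f x); have e2 := enorm_ge0 (f x - x).
    have e3 := enorm_ge0 (x : 'rV[R]_d).
    have c0 : 0 <= c := le_trans e2 h2.
    have h3 : enorm (f x) <= c + enorm (x : 'rV[R]_d) by apply: le_trans h _; rewrite lerD2r.
    have h4 : enorm (f x) ^+ 2 <= (c + enorm (x : 'rV[R]_d)) ^+ 2.
      by rewrite ler_sqr ?nnegrE ?addr_ge0.
    apply: le_trans h4 _; have := sqr_ge0 (c - enorm (x : 'rV[R]_d)).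
    by rewrite sqrrB sqrrD; lra.
  rewrite ge0_integralD //=; last first.
  - by move=> x _; rewrite lee_fin mulr_ge0 ?sqr_ge0.
  - by apply: emeasurable_funM => //; exact: sqr_enorm_measurable.
  - by move=> x _; rewrite mule_ge0 // lee_fin sqr_ge0.
  rewrite integral_cst // [X in (_ * X)%E](_ : _ = 1%E); last first.
    exact: probability_setT.
  rewrite mule1 ge0_integralZl //; last 2 first.
  - exact: sqr_enorm_measurable.
  - by move=> x _; rewrite lee_fin sqr_ge0.
  by rewrite lte_add_pinfty ?ltry // lte_mul_pinfty // prob2_moment.
have ex : exists nu : prob2 R d, forall A : set bV, measurable A -> nu A = mu (f @^-1` A).
  by exists (Prob2 mom).
exact: (xgetPex mu ex).
Qed.

Lemma tdist_ge0 (x y : 'rV[R]_d) : 0 <= tdist x y.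
Proof.
apply: lb_le_inf; first by exists (enorm (x - y + 0)), 0 => //; exact: Zlat0.
by move=> _ [k _ <-]; exact: enorm_ge0.
Qed.

Lemma tdist_le_enorm (x y : 'rV[R]_d) : tdist x y <= enorm (x - y).
Proof.
apply: ge_inf; first by exists 0 => _ [k _ <-]; exact: enorm_ge0.
by exists 0; [exact: Zlat0|rewrite addr0].
Qed.

Import HBNNSimple.

(** The coupling is the image of mu by (f1, f2), under which the cost is at most
    c^2 everywhere. *)
Lemma wass_le_of_transport (mu nu1 nu2 : prob2 R d) f1 f2 c :
  measurable_fun setT (f1 : bV -> bV) -> measurable_fun setT (f2 : bV -> bV) ->
  (forall A : set bV, measurable A -> nu1 A = mu (f1 @^-1` A)) ->
  (forall A : set bV, measurable A -> nu2 A = mu (f2 @^-1` A)) ->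
  (forall q, enorm (f1 q - f2 q) <= c) ->
  wass nu1 nu2 <= c.
Proof.
move=> m1 m2 h1 h2 fc.
have c0 : 0 <= c := le_trans (enorm_ge0 _) (fc 0).
have mp := measurable_fun_pair m1 m2.
pose F : {mfun bV >-> (bV * bV)%type} := mfun_Sub (mem_set mp).
pose gamma : probability (bV * bV)%type R := distribution mu F.
have cpl : coupling nu1 nu2 gamma.
  move=> A mA; rewrite h1 // h2 //; split; rewrite /gamma /= /distribution /pushforward.
    by congr (mu _); apply/seteqP; split => x //= [].
  by congr (mu _); apply/seteqP; split => x //= [].
have cost : (tcost gamma <= (c ^+ 2)%:E)%E.
  rewrite /tcost ge0_integralTE; last by move=> z; rewrite lee_fin sqr_ge0.
  (* [tdist] is an infimum over the lattice; the simple functions below the cost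
     are measurable, and it is enough to bound their integrals. *)
  apply: ge_ereal_sup => _ [h /= hle <-].
  rewrite -integralT_nnsfun (ge0_integral_pushforward mp) //=; last 2 first.
  - by apply/measurable_EFinP; exact: measurable_funP.
  - by move=> x _; rewrite lee_fin.
  rewrite preimage_setT; apply: (@le_trans _ _ (\int[mu]_x (c ^+ 2)%:E)%E); last first.
    rewrite integral_cst // [X in (_ * X)%E](_ : _ = 1%E); last first.
      exact: probability_setT.
    by rewrite mule1.
  apply: ge0_le_integral => //.
  - by move=> x _; rewrite lee_fin.
  - apply/measurable_EFinP; exact: (measurableT_comp _ mp).
  move=> x _ /=; apply: le_trans (hle _) _; rewrite lee_fin /=.
  rewrite ler_sqr ?nnegrE ?tdist_ge0 //.
  exact: le_trans (tdist_le_enorm _ _) (fc x).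
have inf_le : (ereal_inf [set tcost g | g in coupling nu1 nu2] <= (c ^+ 2)%:E)%E.
  by apply: ereal_inf_le; exists (tcost gamma) => //; exists gamma.
have inf_ge0 : (0 <= ereal_inf [set tcost g | g in coupling nu1 nu2])%E.
  apply: le_ereal_inf_tmp => _ [g _ <-].
  by apply: integral_ge0 => z _; rewrite lee_fin sqr_ge0.
rewrite /wass -[leRHS]ger0_norm // -sqrtr_sqr ler_wsqrtr //.
by case: (ereal_inf _) inf_le inf_ge0 => //=.
Qed.

Lemma wassxx mu : wass mu mu = 0.
Proof.
apply/eqP; rewrite eq_le sqrtr_ge0 andbT.
apply: (@wass_le_of_transport mu mu mu id id) => // q.
by rewrite subrr enorm0.
Qed.

Lemma wass_push_le mu f1 f2 c1 c2 c :
  measurable_fun setT (f1 : bV -> bV) -> measurable_fun setT (f2 : bV -> bV) ->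
  (forall q, enorm (f1 q - q) <= c1) -> (forall q, enorm (f2 q - q) <= c2) ->
  (forall q, enorm (f1 q - f2 q) <= c) ->
  wass (push f1 mu) (push f2 mu) <= c.
Proof.
move=> m1 m2 b1 b2 fc; apply: (@wass_le_of_transport mu _ _ f1 f2) => //.
  exact: push_measurable_spec b1.
exact: push_measurable_spec b2.
Qed.

End Pushforward.

(** * The continuity equation *)

(** The fundamental theorem of calculus on an interval [a', b'] slightly larger
    than [a, b]: F vanishes at its endpoints, and f vanishes outside it. *)
Lemma integral_derivative_compact_support (R : realType) (F f : R -> R)
    (T a b : R) : 0 < T -> 0 < a -> b < T ->
  (forall t : R, 0 < t < T -> is_derive t 1 F (f t)) ->
  (forall t : R, 0 < t < T -> {for t, continuous f}) ->
  (forall t : R, ~~ (a <= t <= b) -> F t = 0) ->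
  \int[lebesgue_measure]_(t in `]0, T[) f t = 0.
Proof.
move=> T0 a0 bT dF cf F0.
(* The bounds T / 2 keep a' < b' even when a > b. *)
pose a' := Num.min a (T / 2) / 2; pose b' := (Num.max b (T / 2) + T) / 2.
have [a'0 a'a a'T] : [/\ 0 < a', a' < a & a' < T / 2].
  have m0 : 0 < Num.min a (T / 2) by rewrite lt_min a0 divr_gt0.
  have h : a' < Num.min a (T / 2) by rewrite /a'; lra.
  by split; [rewrite /a' divr_gt0|move: h; rewrite lt_min => /andP[]..].
have [b'T bb' Tb'] : [/\ b' < T, b < b' & T / 2 < b'].
  have m0 : Num.max b (T / 2) < T by rewrite gt_max bT; lra.
  have h : Num.max b (T / 2) < b' by rewrite /b'; lra.
  by split; [rewrite /b'; lra|move: h; rewrite gt_max => /andP[]..].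
have ab' : a' < b' := lt_trans a'T Tb'.
have inT t : a' <= t <= b' -> 0 < t < T.
  by move=> /andP[h1 h2]; rewrite (lt_le_trans a'0 h1) (le_lt_trans h2 b'T).
have f0 t : 0 < t < T -> ~~ (a' <= t <= b') -> f t = 0.
  move=> tT; rewrite negb_and -!ltNge => tab.
  have Fn : \forall u \near t, F u = 0.
    case/orP: tab => ht.
      near=> u; apply: F0; rewrite negb_and -ltNge.
      suff -> : u < a by [].
      by near: u; apply: lt_nbhsl; exact: lt_trans ht a'a.
    near=> u; apply: F0; rewrite negb_and -!ltNge orbC.
    suff -> : b < u by [].
    by near: u; apply: lt_nbhsr; exact: lt_trans bb' ht.
  have [_ <-] := dF t tT.
  have -> : derive F t 1 = derive (cst (0 : R)) t 1.
    by apply: near_eq_derive => //; rewrite oner_eq0.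
  exact: derive_cst.
have Rm : \int[lebesgue_measure]_(t in `]0, T[) f t =
          \int[lebesgue_measure]_(t in `[a', b']) f t.
  rewrite Rintegral_mkcond [RHS]Rintegral_mkcond; congr (Rintegral _ _ _).
  apply/funext => t; rewrite /patch !mem_setE !in_itv /=.
  case: ifPn => h; case: ifPn => h' //; first exact: f0.
  by move: h; rewrite inT.
rewrite Rm /Rintegral.
have dcont : derivable_oo_LRcontinuous F a' b'.
  have cF t : 0 < t < T -> {for t, continuous F}.
    move=> tT; apply: differentiable_continuous; apply/derivable1_diffP.
    by have [] := dF t tT.
  split.
  - move=> t; rewrite in_itv /= => /andP[h1 h2].
    by have [|//] := dF t (inT _ _); rewrite !ltW.
  - apply: cvg_at_right_filter; apply: cF; apply: inT; by rewrite lexx ltW.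
  - apply: cvg_at_left_filter; apply: cF; apply: inT; by rewrite lexx ltW.
have Fa : F a' = 0 by apply: F0; rewrite negb_and -!ltNge a'a.
have Fb : F b' = 0 by apply: F0; rewrite negb_and -!ltNge bb' orbT.
rewrite (@continuous_FTC2 R f F a' b') //.
- by rewrite Fa Fb /= subrr.
- apply: continuous_in_subspaceT => t; rewrite inE /= in_itv /= => /inT tT.
  exact: cf.
- move=> t; rewrite in_itv /= => /andP[h1 h2].
  rewrite derive1E; have [|_ //] := dF t (inT _ _); by rewrite !ltW.
Unshelve. all: by end_near. Qed.

Lemma bounded_integrable (R : realType) (d : nat) (mu : prob2 R d)
    (h : borel_rV R d -> R) (M : R) :
  measurable_fun setT h -> (forall x, `|h x| <= M) ->
  mu.-integrable setT (EFin \o h).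
Proof.
move=> mh hM; apply: measurable_bounded_integrable => //.
  by apply: le_lt_trans (probability_le1 mu measurableT) _; rewrite ltry.
exists M; split; first exact: num_real.
by move=> N MN x _; exact: le_trans (hM x) (ltW MN).
Qed.

Lemma Rintegral_image (R : realType) (d : nat) (mu nu : prob2 R d)
    (f : 'rV[R]_d -> 'rV[R]_d) (h : 'rV[R]_d -> R) (M : R) :
  measurable_fun setT (f : borel_rV R d -> borel_rV R d) ->
  (forall A : set (borel_rV R d), measurable A -> nu A = mu (f @^-1` A)) ->
  measurable_fun setT (h : borel_rV R d -> R) ->
  (forall x, `|h (f x)| <= M) ->
  \int[nu]_x h x = \int[mu]_x h (f x).
Proof.
move=> mf nuE mh hM; rewrite /Rintegral; congr fine.
rewrite (eq_measure_integral
  (pushforward mu (f : borel_rV R d -> borel_rV R d))); last first.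
  by move=> A mA _; exact: nuE.
rewrite (integral_pushforward mf) //.
  exact/measurable_EFinP.
rewrite preimage_setT.
exact: (bounded_integrable mu (measurableT_comp mh mf) hM).
Qed.

Section TimeSpaceCalculus.
Variables (R : realType) (d : nat).
Local Notation sp := (R * 'rV[R]_d)%type.
Implicit Types phi : sp -> R.

Lemma is_derive_along_curve phi (c : R -> 'rV[R]_d) c' (t : R) :
  differentiable phi (t, c t) -> is_derive t 1 c c' ->
  is_derive t 1 (fun u => phi (u, c u))
    (derive (fun u => phi (u, c t)) t 1 + dot (grad (fun x => phi (t, x)) (c t)) c').
Proof.
move=> pd cd.
have cdiff : differentiable c t by apply/derivable1_diffP; have [] := cd.
have sd : differentiable (fun x => phi (t, x)) (c t).
  exact: (@differentiable_comp _ _ _ _ (fun x => (t, x)) phi).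
have gd : differentiable (fun u : R => (u, c u)) t by exact: differentiable_pair.
have comp : differentiable (phi \o (fun u : R => (u, c u))) t.
  exact: differentiable_comp.
apply: DeriveDef; first exact: diff_derivable.
rewrite -derive_dot // derive_time derive_space.
rewrite [LHS](deriveE _ comp) diff_comp //= diff_pair //=.
have -> : 'd c t 1 = c' by rewrite -deriveE //; exact: derive_val.
rewrite !deriveE // -linearD; congr ('d phi (t, c t) _).
have -> : 'd id t 1 = 1 :> R by rewrite diff_val.
by apply: injective_projections => /=; rewrite ?addr0 ?add0r.
Qed.

End TimeSpaceCalculus.

Section ContinuityEquation.
Variables (R : realType) (d : nat).
Local Notation bV := (borel_rV R d).
Local Notation sp := (R * 'rV[R]_d)%type.
Variables (T L : R) (mu : prob2 R d) (nu : R -> prob2 R d)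
  (Q v w : R -> 'rV[R]_d -> 'rV[R]_d) (phi : sp -> R).
Hypothesis T0 : 0 < T.
Hypothesis hphi : torus_test T phi.
Hypothesis dQ : forall (t : R) q, 0 < t < T -> is_derive t 1 (Q ^~ q) (v t q).
Hypothesis vL : forall (t : R) q, 0 < t < T -> enorm (v t q) <= L.
Hypothesis cv : forall (t : R) q, 0 < t < T -> {for t, continuous (v ^~ q)}.
Hypothesis mQ : forall t : R, 0 < t < T -> measurable_fun setT (Q t : bV -> bV).
Hypothesis wv : forall (t : R) q, 0 < t < T -> w t (Q t q) = v t q.
Hypothesis cw : forall t : R, 0 < t < T -> continuous (w t).
Hypothesis nuE : forall t : R, 0 < t < T ->
  forall A : set bV, measurable A -> nu t A = mu (Q t @^-1` A).

Let g1 t x := derive (fun t' => phi (t', x)) t 1.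
Let g2 t x := grad (fun x' => phi (t, x')) x.
Let Dphi t q := g1 t (Q t q) + dot (g2 t (Q t q)) (v t q).

Let phid y : differentiable phi y.
Proof. by have [/(_ 1) [h _] _ _] := hphi; exact: h. Qed.

Let cDphi e : continuous (fun y : sp => derive phi y e).
Proof. by have [/(_ 1) [_ h] _ _] := hphi; move=> y; exact: h. Qed.

Let cg1 : continuous (fun y : sp => g1 y.1 y.2).
Proof.
have -> : (fun y : sp => g1 y.1 y.2) = (fun y : sp => derive phi y (1, 0)).
  by apply/funext => -[t x]; rewrite /g1 derive_time.
exact: cDphi.
Qed.

Let cg2 i : continuous (fun y : sp => g2 y.1 y.2 0 i).
Proof.
have -> : (fun y : sp => g2 y.1 y.2 0 i) =
    (fun y : sp => derive phi y (0, ebase R i)).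
  by apply/funext => -[t x]; rewrite /g2 grad_space mxE.
exact: cDphi.
Qed.

Let per_derive e t : periodic (fun x => derive phi (t, x) e).
Proof.
move=> x k kZ; have [_ pphi _] := hphi.
have -> : (t, x + k) = (t, x) + (0, k) :> sp.
  by apply: injective_projections => //=; rewrite addr0.
apply: derive_translation => -[u y].
have -> : (u, y) + (0, k) = (u, y + k) :> sp.
  by apply: injective_projections => //=; rewrite addr0.
exact: pphi.
Qed.

Let bounded_on_torus (h : R -> 'rV[R]_d -> R) :
  continuous (fun y : sp => h y.1 y.2) -> (forall t, periodic (h t)) ->
  exists2 C : R, 0 <= C & forall t x, 0 < t < T -> `|h t x| <= C.
Proof.
move=> ch ph.
have [C C0 hC] := periodic_bounded (@segment_compact R 0 T) ch ph.
by exists C => // t x /andP[t0 tT]; apply: hC; rewrite /= in_itv /= !ltW.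
Qed.

Let Dphi_bounded : exists M : R, forall t q, 0 < t < T -> `|Dphi t q| <= M.
Proof.
have [M1 M10 h1] : exists2 C : R, 0 <= C & forall t x, 0 < t < T -> `|g1 t x| <= C.
  apply: bounded_on_torus => // t x k kZ; rewrite /g1 !derive_time.
  exact: per_derive.
have [M2 M20 h2] : exists2 C : R, 0 <= C &
    forall i y, [set y : sp | 0 < y.1 < T] y -> `|g2 y.1 y.2 0 i| <= C.
  apply: (@finite_common_bound R d sp _ (fun i y => g2 y.1 y.2 0 i)) => i.
  have [||C C0 hC] := bounded_on_torus (h := fun t x => g2 t x 0 i).
  - exact: cg2.
  - by move=> t x k kZ; rewrite /g2 !grad_space !mxE; exact: per_derive.
  by exists C => // -[t x] /= tT; exact: hC.
exists (M1 + d%:R * M2 * L) => t q tT.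
apply: le_trans (ler_normD _ _) _; apply: lerD; first exact: h1.
apply: le_trans (abs_dot_le _ _) _; apply: ler_pM; rewrite ?enorm_ge0 ?vL //.
apply: enorm_le_coord => // i; exact: (h2 i (t, Q t q)).
Qed.

Let is_derive_phi t q : 0 < t < T ->
  is_derive t 1 (fun u => phi (u, Q u q)) (Dphi t q).
Proof. by move=> tT; exact: is_derive_along_curve (phid _) (dQ q tT). Qed.

Let cDt t q : 0 < t < T -> {for t, continuous (Dphi ^~ q)}.
Proof.
move=> tT; have cQ : Q u q @[u --> t] --> Q t q.
  apply: differentiable_continuous; apply/derivable1_diffP.
  by have [] := dQ q tT.
have cc : (u, Q u q) @[u --> t] --> (t, Q t q).
  exact: (cvg_pair (@cvg_id _ (nbhs t)) cQ).
apply: cvgD.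
  by have := continuous_cvg _ (@cg1 (t, Q t q)) cc; exact.
apply: cvg_big => [|i _]; first exact: add_continuous.
apply: cvgM; last first.
  by have := cvg_coord (i := 0) (j := i) (@cv t q tT); exact.
by have := continuous_cvg _ (@cg2 i (t, Q t q)) cc; exact.
Qed.

Let psi t x := g1 t x + dot (g2 t x) (w t x).

Let cpsi t : 0 < t < T -> continuous (psi t).
Proof.
move=> tT x; have cc : (t, y) @[y --> x] --> (t, x).
  exact: (cvg_pair (cvg_cst t) (@cvg_id _ (nbhs x))).
have h1 : g1 t y @[y --> x] --> g1 t x.
  by have := continuous_cvg _ (@cg1 (t, x)) cc; apply.
have h2 i : g2 t y 0 i * w t y 0 i @[y --> x] --> g2 t x 0 i * w t x 0 i.
  have h3 : g2 t y 0 i @[y --> x] --> g2 t x 0 i.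
    by have := continuous_cvg _ (@cg2 i (t, x)) cc; apply.
  exact: cvgM h3 (cvg_coord (@cw t tT x)).
have h4 : dot (g2 t y) (w t y) @[y --> x] --> dot (g2 t x) (w t x).
  exact: cvg_dot_coord h2.
exact: cvgD h1 h4.
Qed.

Let psiQ t q : 0 < t < T -> psi t (Q t q) = Dphi t q.
Proof. by move=> tT; rewrite /psi wv. Qed.

Let measurable_along (h : 'rV[R]_d -> R) t : 0 < t < T -> continuous h ->
  measurable_fun setT (fun q : bV => h (Q t q)).
Proof.
move=> tT ch.
exact: (measurableT_comp (continuous_measurable_real ch) (mQ tT)).
Qed.

(** Here v is the velocity of the particle with label q and w the same velocity
    as a function of the position.  After transport to the label space the inner
    integral is the integral of [Dphi] against the fixed measure mu, which is the
    derivative of t -> int phi (t, Q t q) mu(dq): both phi and its derivatives are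
    bounded by periodicity, so one may differentiate under the integral. *)
Lemma continuity_equation :
  \int[lebesgue_measure]_(t in `]0, T[) (\int[nu t]_x
    (derive (fun t' => phi (t', x)) t 1 +
     dot (grad (fun x' => phi (t, x')) x) (w t x))) = 0.
Proof.
have [M hM] := Dphi_bounded.
have cphi : continuous (fun y : sp => phi (y.1, y.2)).
  have -> : (fun y : sp => phi (y.1, y.2)) = phi by apply/funext => -[].
  by move=> y; exact: differentiable_continuous.
have [_ pphi [a [b [a0 bT phi0]]]] := hphi.
have [M0 M00 hM0] := bounded_on_torus (h := fun t x => phi (t, x)) cphi pphi.
have mD t : 0 < t < T -> measurable_fun setT (Dphi t : bV -> R).
  move=> tT; have -> : Dphi t = (fun q => psi t (Q t q)).
    by apply/funext => q; rewrite psiQ.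
  by apply: measurable_along => //; exact: cpsi.
have Tin t : `]0, T[%classic t -> 0 < t < T by rewrite /= in_itv.
have -> : \int[lebesgue_measure]_(t in `]0, T[) (\int[nu t]_x psi t x) =
    \int[lebesgue_measure]_(t in `]0, T[) (\int[mu]_q Dphi t q).
  apply: eq_Rintegral => t; rewrite inE => /Tin tT.
  rewrite (@Rintegral_image _ _ mu (nu t) (Q t) (psi t) M) //.
  - by apply: eq_Rintegral => q _; rewrite psiQ.
  - exact: mQ.
  - exact: nuE.
  - exact: continuous_measurable_real (cpsi tT).
  - by move=> q; rewrite psiQ //; exact: hM.
apply: (@integral_derivative_compact_support R
    (fun t => \int[mu]_q phi (t, Q t q)) _ T a b) => //.
- move=> t tT.
  pose Phi (u : R) (q : bV) := phi (u, Q u q).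
  have intPhi u : `]0, T[%classic u -> mu.-integrable setT (EFin \o Phi u).
    move=> /Tin uT; apply: (@bounded_integrable _ _ _ _ M0).
      apply: (measurable_along (h := fun x => phi (u, x))) => // x.
      have cc : (u, y) @[y --> x] --> (u, x).
        exact: (cvg_pair (cvg_cst u) (@cvg_id _ (nbhs x))).
      by have := continuous_cvg _ (cphi (u, x)) cc; exact.
    by move=> q; exact: hM0.
  have derPhi u (q : bV) : `]0, T[%classic u -> setT q -> derivable (Phi ^~ q) u 1.
    by move=> /Tin uT _; have [] := is_derive_phi q uT.
  have d1 u (q : bV) : 0 < u < T -> partial1of2 Phi u q = Dphi u q.
    by move=> uT; rewrite partial1of2E; have [_] := is_derive_phi q uT.
  have bdPhi u (q : bV) : `]0, T[%classic u -> setT q ->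
      `|partial1of2 Phi u q| <= `|M|.
    move=> /Tin uT _; rewrite d1 //.
    exact: le_trans (hM _ _ uT) (ler_norm _).
  have intM := @finite_measure_integrable_cst _ bV R mu setT `|M| measurableT.
  have tI : `]0, T[%classic t by rewrite /= in_itv.
  apply: DeriveDef.
    exact: (derivable_under_integral measurableT tI intPhi derPhi
      (fun=> normr_ge0 M) intM bdPhi).
  rewrite -derive1E.
  rewrite (differentiation_under_integral measurableT tI intPhi derPhi
      (fun=> normr_ge0 M) intM bdPhi).
  by apply: eq_Rintegral => q _; rewrite d1.
- move=> t tT.
  have intD u : `]0, T[%classic u -> mu.-integrable setT (EFin \o (Dphi u : bV -> R)).
    move=> /Tin uT; apply: (@bounded_integrable _ _ _ _ M); first exact: mD.
    by move=> q; exact: hM.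
  have cD : {ae mu, forall q : bV, setT q -> {in `]0, T[%classic, continuous (Dphi ^~ q)}}.
    by apply: aeW => q _ u; rewrite inE => /Tin; exact: cDt.
  have intM := @finite_measure_integrable_cst _ bV R mu setT M measurableT.
  have bdD u : `]0, T[%classic u -> {ae mu, forall q : bV, setT q -> `|Dphi u q| <= M}.
    by move=> /Tin uT; apply: aeW => q _; exact: hM.
  apply: (continuity_under_integral measurableT intD cD intM bdD).
  by rewrite inE /= in_itv.
move=> t tab; transitivity (\int[mu]_(q in [set: bV]) (0 : R)).
  by apply: eq_Rintegral => q _; exact: phi0.
by rewrite Rintegral_cst // mul0r.
Qed.

End ContinuityEquation.

(** * The characteristics solve the mean field game system *)

Lemma continuous_of_sqr_lipschitz (R : realType) (d : nat)
    (f : 'rV[R]_d -> 'rV[R]_d) (C : R) :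
  (forall x y, enorm (f y - f x) ^+ 2 <= C * enorm (y - x) ^+ 2) ->
  continuous f.
Proof.
move=> fC x.
have h : Num.sqrt (C * enorm (y - x) ^+ 2) @[y --> x] --> (0 : R).
  have h1 : C * enorm (y - x) ^+ 2 @[y --> x] --> C * enorm (x - x) ^+ 2.
    have h2 : enorm (y - x) @[y --> x] --> enorm (x - x).
      exact: (cvg_enorm (cvgB (@cvg_id _ (nbhs x)) (cvg_cst x))).
    exact: cvgM (cvg_cst C) (cvgM h2 h2).
  have := continuous_cvg _ (@sqrt_continuous R _) h1.
  by rewrite subrr enorm0 expr0n mulr0 sqrtr0; apply.
have h' : enorm (f y - f x) @[y --> x] --> (0 : R).
  apply: squeeze0 h; apply: nearW => y; rewrite enorm_ge0 /=.
  by rewrite -[leLHS]ger0_norm ?enorm_ge0 // -sqrtr_sqr ler_wsqrtr.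
exact: cvg_enorm0P h'.
Qed.

Lemma continuous_time_slice (R : realType) (d : nat) (T : R)
    (Y : R -> 'rV[R]_d -> 'rV[R]_d) :
  {within @slab R d T, continuous (fun w => Y w.1 w.2)} ->
  forall q, {within `[0, T], continuous (Y ^~ q)}.
Proof.
move=> /subspace_continuousP cY q; apply/subspace_continuousP => t.
rewrite /= in_itv /= => tT W /(cY (t, q) tT) h.
have cc : (u, q) @[u --> t] --> (t, q).
  exact: (cvg_pair (@cvg_id _ (nbhs t)) (cvg_cst q)).
have h' : \forall u \near t, slab T (u, q) -> W (Y u q) := cc _ h.
suff : \forall u \near t, `[0, T]%classic u -> W (Y u q) by [].
by apply: filterS h' => u hu /=; rewrite in_itv /=; exact: hu.
Qed.

Section Solution.
Variables (R : realType) (d : nat).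
Local Notation bV := (borel_rV R d).
Local Notation sp := (R * 'rV[R]_d)%type.
Variables (H : 'rV[R]_d -> 'rV[R]_d -> R) (F g : 'rV[R]_d -> prob2 R d -> R)
  (kappa B L K T s : R) (mu : prob2 R d) (Q P X : R -> 'rV[R]_d -> 'rV[R]_d)
  (z : R -> 'rV[R]_d -> R).
Hypothesis hH : Hassumption H.
Hypothesis hF : Fassumption kappa F.
Hypothesis hg : Fassumption kappa g.
Hypothesis kappa0 : 0 <= kappa.
Hypothesis L0 : 0 <= L.
Hypothesis KE : K = 1 + L + kappa.
Hypothesis smallT : 16 * K ^+ 3 * T <= 1.
Hypothesis HL : forall q p q' p', enorm p <= B -> enorm p' <= B ->
   [/\ enorm (gradp H q p) <= L,
       enorm (gradq H q' p' - gradq H q p) <= L * (enorm (q' - q) + enorm (p' - p)) &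
       enorm (gradp H q' p' - gradp H q p) <= L * (enorm (q' - q) + enorm (p' - p))].
Hypothesis sT : 0 < s < T.
Hypothesis Qtorus : forall t : R, 0 <= t <= T -> torus_map (Q t).
Hypothesis Ptorus : forall t : R, 0 <= t <= T -> periodic (P t).
Hypothesis Qslab : {within @slab R d T, continuous (fun w => Q w.1 w.2)}.
Hypothesis Pslab : {within @slab R d T, continuous (fun w => P w.1 w.2)}.
Hypothesis PB : forall (t : R) q, 0 <= t <= T -> enorm (P t q) <= B.
Hypothesis ham : ham_system H F g T s mu Q P.
Let sigma t := push (Q t) mu.
Hypothesis Xinv : forall t : R, 0 <= t <= T -> torus_inverse (Q t) (X t).
Hypothesis cz : forall q, {within `[0, T[, continuous (z ^~ q)}.
Hypothesis dz : forall (t : R) q, 0 < t < T -> is_derive t 1 (z ^~ q)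
  (dot (P t q) (gradp H (Q t q) (P t q)) - H (Q t q) (P t q) - F (Q t q) (sigma t)).
Hypothesis z0 : forall q, z 0 q = g (Q 0 q) (sigma 0).
Let U t x := z t (X t x).
Let f t x := F x (sigma t).

Let T0 : 0 < T. Proof. by case/andP: sT => s0 /(lt_trans s0). Qed.

Let sT' : 0 <= s <= T. Proof. by have /andP[/ltW -> /ltW ->] := sT. Qed.

Let zT : 0 <= (0 : R) <= T. Proof. by rewrite lexx ltW // T0. Qed.

Let oc (t : R) : 0 < t < T -> 0 <= t <= T.
Proof. by move=> /andP[/ltW -> /ltW ->]. Qed.

Let Hd y : differentiable (fun y : 'rV[R]_d * 'rV[R]_d => H y.1 y.2) y.
Proof. by have [_ [h _]] := hH; exact: h. Qed.

Let potential_differentiable (G : 'rV[R]_d -> prob2 R d -> R) nu x :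
  Fassumption kappa G -> differentiable (G ^~ nu) x.
Proof. by move=> hG; have [h _] := Fa_C3 hG nu; exact: h. Qed.

Let potential_gradient_lipschitz (G : 'rV[R]_d -> prob2 R d -> R) nu x y :
  Fassumption kappa G ->
  enorm (grad (G ^~ nu) x - grad (G ^~ nu) y) <= kappa * enorm (x - y).
Proof.
move=> hG; have := Fa_lipschitz hG x nu y nu.
by rewrite wassxx expr0n addr0 sqrtr_sqr ger0_norm ?enorm_ge0.
Qed.

Let cQ := continuous_time_slice Qslab.
Let cP := continuous_time_slice Pslab.

Let fL (t : R) x y : enorm (grad (f t) x - grad (f t) y) <= kappa * enorm (x - y).
Proof. exact: potential_gradient_lipschitz. Qed.

Let gL x y : enorm (grad (g ^~ (sigma 0)) x - grad (g ^~ (sigma 0)) y) <=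
  kappa * enorm (x - y).
Proof. exact: potential_gradient_lipschitz. Qed.

Let fd (t : R) x : differentiable (f t) x.
Proof. exact: potential_differentiable. Qed.

Let gd x : differentiable (g ^~ (sigma 0)) x.
Proof. exact: potential_differentiable. Qed.

Let lip q q' (t u : R) : 0 <= t <= T -> 0 <= u <= T ->
  enorm (Q u q' - Q u q) ^+ 2 + enorm (P u q' - P u q) ^+ 2 <=
  4 * K ^+ 2 * enorm (Q t q' - Q t q) ^+ 2.
Proof.
exact: (flow_lipschitz KE L0 kappa0 T0 smallT HL fL gL cQ cP PB
  (ham_Q ham) (ham_P ham) (ham_0 ham)).
Qed.

Let taylor q q' (t : R) : 0 <= t < T ->
  `|z t q' - z t q - dot (P t q) (Q t q' - Q t q)| <=
  5 * K ^+ 3 * enorm (Q t q' - Q t q) ^+ 2.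
Proof.
exact: (action_taylor KE L0 kappa0 T0 smallT Hd HL fd fL gd gL cQ cP PB
  (ham_Q ham) (ham_P ham) (ham_0 ham) q q' cz dz z0).
Qed.

Let speed q (t t' : R) : 0 <= t <= T -> 0 <= t' <= T ->
  enorm (Q t' q - Q t q) <= L * `|t' - t|.
Proof. exact: (flow_speed HL cQ PB (ham_Q ham)). Qed.

(** Integer valued and continuous in time, the increment Q(t,q+k) - Q(t,q) keeps
    the value k that it has at t = s. *)
Let flow_degree_one (t : R) q k : 0 <= t <= T -> Zlat k -> Q t (q + k) = Q t q + k.
Proof.
move=> tT kZ; apply/rowP => i; rewrite mxE.
have cont : {within `[0, T], continuous (fun u => (Q u (q + k) - Q u q) 0 i)}.
  by move=> u; apply: cvg_coord; apply: cvgB; exact: cQ.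
have int u : 0 <= u <= T -> (Q u (q + k) - Q u q) 0 i \is a Num.int.
  by move=> uT; apply: (Qtorus uT); rewrite addrAC subrr add0r.
have := integer_valued_continuous cont int tT sT'.
by rewrite !(ham_s ham) addrAC subrr add0r !mxE => /eqP; rewrite subr_eq addrC => /eqP.
Qed.

(** By periodicity of H, F and P, the equations of z at q and q + k have the same
    right hand side, and by periodicity of g the same initial value. *)
Let z_periodic (t : R) : 0 <= t < T -> periodic (z t).
Proof.
move=> /andP[t0 tT] q k kZ.
have z0k : z 0 (q + k) = z 0 q.
  by rewrite !z0 flow_degree_one // (Fa_periodic hg).
apply/eqP; rewrite -subr_eq0; apply/eqP.
have : `|(z t (q + k) - z t q) - (z 0 (q + k) - z 0 q)| <= 0 * (t - 0).
  apply: (@mvt_bound R (fun u => z u (q + k) - z u q) (fun=> 0)) => //.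
  - move=> x /andP[x0 xt]; have xT : 0 < x < T by rewrite x0 (lt_trans xt).
    apply: is_derive_eq (is_deriveB (dz (q + k) xT) (dz q xT)) _.
    rewrite flow_degree_one ?oc // (Ptorus (oc xT)) // (Fa_periodic hF) //.
    have [pH _] := hH.
    rewrite /gradp (_ : H (Q x q + k) = H (Q x q)) ?subrr //.
    by apply/funext => p; exact: pH.
  - have czt y : {within `[0, t], continuous (z ^~ y)}.
      apply: continuous_subspaceW (cz (q := y)) => x /=.
      by rewrite !in_itv /= => /andP[-> /le_lt_trans ->].
    by move=> x; apply: cvgB; exact: czt.
  by move=> x _; rewrite normr0.
by rewrite mul0r normr_le0 z0k subrr subr0 => /eqP.
Qed.

(** The inverse of Q(t) as a map of R^d, obtained by correcting X, which inverts it
    modulo the lattice, by a lattice vector. *)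
Let Y t x := X t x + (x - Q t (X t x)).

Let shift_lattice (t : R) x : 0 <= t <= T -> Zlat (x - Q t (X t x)).
Proof. by move=> tT; have [_ _ h] := Xinv tT; rewrite -opprB; apply: ZlatN. Qed.

Let QY (t : R) x : 0 <= t <= T -> Q t (Y t x) = x.
Proof.
move=> tT; rewrite /Y flow_degree_one //; last exact: shift_lattice.
by rewrite addrC subrK.
Qed.

Let UE (t : R) x : 0 <= t < T -> U t x = z t (Y t x).
Proof.
move=> tT; rewrite /Y z_periodic //; apply: shift_lattice.
by have /andP[-> /ltW ->] := tT.
Qed.

Let YQ (t : R) q : 0 <= t <= T -> Y t (Q t q) = q.
Proof.
move=> tT; have := lip q (Y t (Q t q)) tT sT'.
rewrite QY // subrr enorm0 expr0n mulr0 !(ham_s ham) => h.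
apply/eqP; rewrite -subr_eq0; apply/eqP; apply: dot_eq0; apply/eqP.
rewrite -sqr_enorm eq_le sqr_ge0 andbT; apply: le_trans h.
by rewrite lerDl sqr_ge0.
Qed.

Let lipP (t : R) q q' : 0 < t < T ->
  enorm (P t q' - P t q) ^+ 2 <= 4 * K ^+ 2 * enorm (Q t q' - Q t q) ^+ 2.
Proof.
by move=> /oc tT; apply: le_trans (lip q q' tT tT); rewrite lerDr sqr_ge0.
Qed.

Let measurable_flow (t : R) : 0 <= t <= T ->
  measurable_fun setT (Q t : bV -> bV).
Proof.
move=> tT; apply: continuous_measurable_rV.
apply: (@continuous_of_sqr_lipschitz R d (Q t) (4 * K ^+ 2)) => x y.
have := lip x y sT' tT; rewrite !(ham_s ham); apply: le_trans.
by rewrite lerDl sqr_ge0.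
Qed.

Let flow_displacement (t : R) : 0 <= t <= T ->
  forall q, enorm (Q t q - q) <= L * `|t - s|.
Proof. by move=> tT q; rewrite -{2}[q](ham_s ham) speed. Qed.

Let sigmaE (t : R) : 0 <= t <= T ->
  forall A : set bV, measurable A -> sigma t A = mu (Q t @^-1` A).
Proof.
move=> tT.
exact: push_measurable_spec (measurable_flow tT) (flow_displacement tT).
Qed.

Let sigma_lipschitz (t u : R) : 0 <= t <= T -> 0 <= u <= T ->
  wass (sigma t) (sigma u) <= L * `|t - u|.
Proof.
move=> tT uT; have h q := speed q uT tT.
exact: (wass_push_le mu (measurable_flow tT) (measurable_flow uT)
  (flow_displacement tT) (flow_displacement uT) h).
Qed.

(** Continuity of F in the measure is known at a fixed point only.  To move the
    point, F(.,sigma_t) is expanded around x0; its gradient there is bounded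
    uniformly in t, being Lipschitz in the measure. *)
Let cf (w : sp) : 0 < w.1 < T -> {for w, continuous (fun w : sp => f w.1 w.2)}.
Proof.
case: w => t0 x0 /= t0T.
pose c := enorm (grad (f t0) x0) + kappa * (L * T).
have near1 : \forall w \near (t0, x0), `|f w.1 w.2 - f t0 x0| <=
    c * enorm (w.2 - x0) + kappa * enorm (w.2 - x0) ^+ 2 + `|f w.1 x0 - f t0 x0|.
  have := @near_time R d T (t0, x0) t0T; apply: filterS => -[t x] /= tT.
  have -> : f t x - f t0 x0 = (f t x - f t x0 - dot (grad (f t) x0) (x - x0)) +
     dot (grad (f t) x0) (x - x0) + (f t x0 - f t0 x0) by ring.
  apply: le_trans (ler_normD _ _) _; rewrite lerD2r.
  apply: le_trans (ler_normD _ _) _; rewrite addrC; apply: lerD.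
    apply: le_trans (abs_dot_le _ _) _; rewrite ler_wpM2r ?enorm_ge0 //.
    rewrite -[X in enorm X](subrK (grad (f t0) x0)).
    apply: le_trans (enormD _ _) _; rewrite addrC lerD2l.
    have := Fa_lipschitz hF x0 (sigma t) x0 (sigma t0).
    rewrite subrr enorm0 expr0n add0r sqrtr_sqr ger0_norm ?sqrtr_ge0 //.
    move/le_trans; apply; rewrite ler_wpM2l //.
    apply: le_trans (sigma_lipschitz (oc tT) (oc t0T)) _; rewrite ler_wpM2l //.
    have /andP[a1 a2] := tT; have /andP[b1 b2] := t0T.
    by rewrite ler_norml; apply/andP; split; lra.
  exact: taylor_grad (fd t) (fL t) x0 x.
have cx : enorm (w.2 - x0) @[w --> (t0, x0)] --> (0 : R).
  have h : enorm (w.2 - x0) @[w --> (t0, x0)] --> enorm (x0 - x0).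
    exact: (cvg_enorm (cvgB (cvg_snd (F := nbhs t0) (G := nbhs x0)) (cvg_cst x0))).
  by move: h; rewrite subrr enorm0; apply.
have ct : `|f w.1 x0 - f t0 x0| @[w --> (t0, x0)] --> (0 : R).
  apply/cvgrPdist_lt => e e0; have [dl dl0 hdl] := Fa_continuous hF x0 (sigma t0) e0.
  have dlL : 0 < dl / (1 + L) by rewrite divr_gt0 // ltr_pwDl.
  have n1 : \forall t \near t0, `|t0 - t| < dl / (1 + L).
    by have /cvgrPdist_lt := @cvg_id _ (nbhs t0); apply.
  have n2 : \forall w \near (t0, x0), `|t0 - (w : sp).1| < dl / (1 + L).
    exact: (cvg_fst (F := nbhs t0) (G := nbhs x0) n1).
  have n3 := @near_time R d T (t0, x0) t0T.
  near=> w.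
  have wT : 0 < w.1 < T by near: w.
  have wd : `|t0 - w.1| < dl / (1 + L) by near: w.
  rewrite sub0r normrN normr_id; apply: hdl.
  apply: le_lt_trans (sigma_lipschitz (oc t0T) (oc wT)) _.
  apply: le_lt_trans (_ : (1 + L) * `|t0 - w.1| < _).
    by rewrite ler_wpM2r // lerDr.
  by rewrite mulrC -ltr_pdivlMr // ltr_pwDl.
have hc : c * enorm (w.2 - x0) + kappa * enorm (w.2 - x0) ^+ 2 +
    `|f w.1 x0 - f t0 x0| @[w --> (t0, x0)] --> (0 : R).
  have e0 : 0 = c * 0 + kappa * (0 * 0) + 0 :> R by rewrite !mulr0 !addr0.
  rewrite [X in _ --> X]e0.
  exact: (cvgD (cvgD (cvgM (cvg_cst c) cx) (cvgM (cvg_cst kappa) (cvgM cx cx))) ct).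
apply/cvgrPdist_le => e e0; move/cvgrPdist_le: hc => /(_ e e0) hc.
near=> w; rewrite distrC; apply: le_trans (near near1 w _) _ => //.
have := near hc w; rewrite sub0r normrN => h.
by apply: le_trans (ler_norm _) (h _).
Unshelve. all: by end_near. Qed.

Let cH : continuous (fun y : 'rV[R]_d * 'rV[R]_d => H y.1 y.2).
Proof. by move=> y; exact: differentiable_continuous. Qed.

Let speed_oo q (t t' : R) : 0 < t < T -> 0 < t' < T ->
  enorm (Q t' q - Q t q) <= L * `|t' - t|.
Proof. by move=> /oc tT /oc t'T; exact: speed. Qed.

Let QY_oo (t : R) x : 0 < t < T -> Q t (Y t x) = x.
Proof. by move=> /oc; exact: QY. Qed.

Let co (t : R) : 0 < t < T -> 0 <= t < T.
Proof. by move=> /andP[/ltW -> ->]. Qed.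

Let UE_oo (t : R) x : 0 < t < T -> U t x = z t (Y t x).
Proof. by move=> /co; exact: UE. Qed.

Let taylor_oo (t : R) q q' : 0 < t < T ->
  `|z t q' - z t q - dot (P t q) (Q t q' - Q t q)| <=
  5 * K ^+ 3 * enorm (Q t q' - Q t q) ^+ 2.
Proof. by move=> /co; exact: taylor. Qed.

Let grad_U (t : R) x : 0 < t < T -> grad (U t) x = P t (Y t x).
Proof.
exact: (value_grad L0 speed_oo (ham_Q ham) (ham_P ham) dz QY_oo UE_oo taylor_oo).
Qed.

Let dt_U (t : R) x : 0 < t < T ->
  derive (U ^~ x) t 1 = - (H x (P t (Y t x)) + f t x).
Proof.
exact: (value_dt L0 speed_oo (ham_Q ham) (ham_P ham) dz QY_oo UE_oo taylor_oo).
Qed.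

Let C1_U : classC 1 [set w : sp | 0 < w.1 < T] (fun w => U w.1 w.2).
Proof.
exact: (value_C1 L0 speed_oo (ham_Q ham) (ham_P ham) dz QY_oo UE_oo lipP
  taylor_oo cH cf).
Qed.

Let sigma_AC2 : AC2 T sigma.
Proof.
exists (fun=> L); split.
- exact: measurable_cst.
- rewrite integral_cst // [X in (_ * X)%E](_ : _ = T%:E); first by rewrite -EFinM ltry.
  have := lebesgue_measure_itv `]0, T[; rewrite /= lte_fin T0 sube0; exact.
move=> t1 t2 t10 t12 t2T.
have h1 : 0 <= t1 <= T by rewrite (ltW t10) (le_trans t12 (ltW t2T)).
have h2 : 0 <= t2 <= T by rewrite (le_trans (ltW t10) t12) (ltW t2T).
apply: le_trans (sigma_lipschitz h1 h2) _.
rewrite Rintegral_cst // [X in fine X](_ : _ = (t2 - t1)%:E).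
  by rewrite distrC ger0_norm // subr_ge0.
have := lebesgue_measure_itv `[t1, t2]; rewrite /= lte_fin.
move: t12; rewrite le_eqVlt => /predU1P[->|t12]; first by rewrite ltxx subrr; exact.
by rewrite t12 -EFinB; exact.
Qed.

Let gradp_momentum_continuous (t : R) : 0 < t < T ->
  continuous (fun x => gradp H x (grad (U t) x)).
Proof.
move=> tT; have tT' := oc tT.
apply: (@continuous_of_sqr_lipschitz R d _ (2 * L ^+ 2 * (1 + 4 * K ^+ 2))) => x y.
rewrite !grad_U //.
have [_ _ h] := HL x y (PB (Y t x) tT') (PB (Y t y) tT').
have := lipP (Y t x) (Y t y) tT; rewrite !QY_oo //.
have a0 := enorm_ge0 (y - x); have b0 := enorm_ge0 (P t (Y t y) - P t (Y t x)).
move: h; set a := enorm (y - x); set b := enorm (P t _ - _) => h1 h2.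
apply: le_trans (_ : (L * (a + b)) ^+ 2 <= _).
  by rewrite ler_sqr ?nnegrE ?mulr_ge0 ?addr_ge0 ?enorm_ge0.
have ab := sqr_ge0 (a - b); rewrite sqrrB in ab.
rewrite exprMn; have -> : 2 * L ^+ 2 * (1 + 4 * K ^+ 2) * a ^+ 2 =
  L ^+ 2 * (2 * (a ^+ 2 + 4 * K ^+ 2 * a ^+ 2)) by ring.
by rewrite ler_wpM2l ?sqr_ge0 // sqrrD; lra.
Qed.

Let velocity_continuous (t : R) q : 0 < t < T ->
  {for t, continuous (fun u => gradp H (Q u q) (P u q))}.
Proof.
move=> tT; have tT' := oc tT.
have cQt : {for t, continuous (Q ^~ q)}.
  apply: differentiable_continuous; apply/derivable1_diffP.
  by have [] := ham_Q ham q tT.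
have cPt : {for t, continuous (P ^~ q)}.
  apply: differentiable_continuous; apply/derivable1_diffP.
  by have [] := ham_P ham q tT.
have dQ0 : enorm (Q u q - Q t q) @[u --> t] --> (0 : R).
  have h : enorm (Q u q - Q t q) @[u --> t] --> enorm (Q t q - Q t q).
    exact: (cvg_enorm (cvgB cQt (cvg_cst (Q t q)))).
  by move: h; rewrite subrr enorm0; apply.
have dP0 : enorm (P u q - P t q) @[u --> t] --> (0 : R).
  have h : enorm (P u q - P t q) @[u --> t] --> enorm (P t q - P t q).
    exact: (cvg_enorm (cvgB cPt (cvg_cst (P t q)))).
  by move: h; rewrite subrr enorm0; apply.
have h0 : L * (enorm (Q u q - Q t q) + enorm (P u q - P t q)) @[u --> t] --> (0 : R).
  have e0 : 0 = L * (0 + 0) :> R by rewrite addr0 mulr0.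
  by rewrite [X in _ --> X]e0; exact: (cvgM (cvg_cst L) (cvgD dQ0 dP0)).
have h1 : enorm (gradp H (Q u q) (P u q) - gradp H (Q t q) (P t q)) @[u --> t]
    --> (0 : R).
  apply: squeeze0 h0; have tI : t \in `]0, T[ by rewrite in_itv.
  have := near_in_itvoo tI; apply: filterS => u; rewrite in_itv /= => /oc uT.
  rewrite enorm_ge0 /=.
  by have [_ _] := HL (Q t q) (Q u q) (PB q tT') (PB q uT).
exact: cvg_enorm0P h1.
Qed.

Let sigma_continuity phi : torus_test T phi ->
  \int[lebesgue_measure]_(t in `]0, T[)
      (\int[sigma t]_q
         (derive (fun t' => phi (t', q)) t 1 +
          dot (grad (fun q' => phi (t, q')) q) (gradp H q (grad (U t) q)))) = 0.
Proof.
move=> hphi.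
have vL (t : R) q : 0 < t < T -> enorm (gradp H (Q t q) (P t q)) <= L.
  by move=> /oc tT; have [] := HL (Q t q) (Q t q) (PB q tT) (PB q tT).
have wv (t : R) q : 0 < t < T ->
    gradp H (Q t q) (grad (U t) (Q t q)) = gradp H (Q t q) (P t q).
  by move=> tT; rewrite grad_U // YQ // oc.
exact: (continuity_equation T0 hphi (ham_Q ham) vL velocity_continuous
  (fun t tT => measurable_flow (oc tT)) wv gradp_momentum_continuous
  (fun t tT => sigmaE (oc tT))).
Qed.

Let zT0 : 0 <= (0 : R) < T. Proof. by rewrite lexx T0. Qed.

Let U_init q : U 0 q = g q (sigma 0).
Proof. by rewrite UE // z0 QY. Qed.

Let near0 : \forall t \near (0 : R)^'+, 0 < t < T.
Proof.
near=> t; apply/andP; split; near: t; first exact: nbhs_right_gt.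
by apply: nbhs_right_lt; exact: T0.
Unshelve. all: by end_near. Qed.

Let cvg_linear0 (C : R) : C * t @[t --> (0 : R)^'+] --> (0 : R).
Proof.
have h : C * t @[t --> (0 : R)] --> C * 0.
  exact: (cvgM (cvg_cst C) (@cvg_id _ (nbhs (0 : R)))).
by move: (cvg_at_right_filter h); rewrite mulr0; apply.
Qed.

Let sigma_trace : wass (sigma t) (sigma 0) @[t --> 0^'+] --> (0 : R).
Proof.
apply: squeeze0 (cvg_linear0 L); apply: filterS near0 => t tT.
rewrite sqrtr_ge0 /=; apply: le_trans (sigma_lipschitz (oc tT) zT) _.
by rewrite subr0 gtr0_norm //; have /andP[] := tT.
Qed.

(** The value U(t,q) is compared with z(t,y) for the label y of the trajectory
    which starts at q; their distance is O(t). *)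
Let U_trace q : U t q @[t --> 0^'+] --> U 0 q.
Proof.
set y := Y 0 q; have Qy : Q 0 y = q by exact: QY.
have cz0 : z t y @[t --> 0^'+] --> z 0 y.
  have T2 : 0 < T / 2 by rewrite divr_gt0 // T0.
  have cz' : {within `[0, T / 2], continuous (z ^~ y)}.
    apply: continuous_subspaceW (cz (q := y)) => x /=; rewrite !in_itv /= => /andP[-> h].
    by apply: le_lt_trans h _; have := T0; lra.
  by have /(continuous_within_itvP _ T2)[] := cz'.
pose C := `|B| * L + 5 * K ^+ 3 * (L ^+ 2 * T).
have B1 t : 0 < t < T -> `|U t q - z t y| <= C * t.
  move=> tT; have /andP[t0 tT'] := tT.
  rewrite UE_oo //; have := taylor_oo y (Y t q) tT; rewrite QY_oo //.
  have hd : enorm (q - Q t y) <= L * t.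
    rewrite -{1}Qy; apply: le_trans (speed y (oc tT) zT) _.
    by rewrite sub0r normrN gtr0_norm.
  have h1 := abs_dot_le (P t y) (q - Q t y).
  have h2 : enorm (P t y) * enorm (q - Q t y) <= `|B| * (L * t).
    apply: ler_pM; rewrite ?enorm_ge0 //.
    exact: le_trans (PB y (oc tT)) (ler_norm B).
  have h3 : enorm (q - Q t y) ^+ 2 <= L ^+ 2 * T * t.
    apply: le_trans (_ : (L * t) ^+ 2 <= _).
      by rewrite ler_sqr ?nnegrE ?enorm_ge0 // mulr_ge0 // ltW.
    by rewrite exprMn expr2 -mulrA [t ^+ 2]expr2 mulrA -!mulrA !ler_wpM2l // ?ler_wpM2r // ltW.
  have h4 : 5 * K ^+ 3 * enorm (q - Q t y) ^+ 2 <= 5 * K ^+ 3 * (L ^+ 2 * T * t).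
    rewrite ler_wpM2l // mulr_ge0 // exprn_ge0 // KE.
    by rewrite !addr_ge0.
  move=> h5; have -> : z t (Y t q) - z t y =
    (z t (Y t q) - z t y - dot (P t y) (q - Q t y)) + dot (P t y) (q - Q t y) by ring.
  apply: le_trans (ler_normD _ _) _; rewrite /C mulrDl addrC; apply: lerD.
    by apply: le_trans h1 _; apply: le_trans h2 _; rewrite mulrA.
  by apply: le_trans h5 _; apply: le_trans h4 _; rewrite !mulrA.
have dU : U t q - z t y @[t --> 0^'+] --> (0 : R).
  have d1 : `|U t q - z t y| @[t --> 0^'+] --> (0 : R).
    apply: squeeze0 (cvg_linear0 C); apply: filterS near0 => t tT.
    by rewrite normr_ge0 B1.
  by move/norm_cvg0P: d1.
have h : U t q - z t y + z t y @[t --> 0^'+] --> 0 + z 0 y := cvgD dU cz0.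
move: h; rewrite add0r (UE q zT0).
have -> : (fun t => U t q - z t y + z t y) = (fun t => U t q).
  by apply/funext => t; rewrite subrK.
exact.
Qed.

Lemma characteristics_solve_mfg : classical_solution H F g T s mu U sigma.
Proof.
split.
- move=> t tT x k kZ; have [Xtor _ _] := Xinv (oc tT).
  have h : Zlat (X t (x + k) - X t x) by apply: Xtor; rewrite addrAC subrr add0r.
  rewrite /U -[X t (x + k)](subrK (X t x)) addrC.
  exact: z_periodic (co tT) _ _ h.
- exact: C1_U.
- exact: sigma_AC2.
- exact: sigma_continuity.
- by move=> t q tT; rewrite dt_U // grad_U // -addrA addNr.
- exact: U_init.
- exact: U_trace.
- exact: sigma_trace.
- move=> phi _ _; rewrite /Rintegral; congr fine.
  apply: eq_measure_integral => A mA _; apply: etrans (sigmaE sT' mA) _.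
  by congr (mu _); apply/seteqP; split => q /=; rewrite (ham_s ham).
Qed.

End Solution.

Theorem theorem4p21 (R : realType) (d : nat) (d_gt0 : (0 < d)%N)
    (H : 'rV[R]_d -> 'rV[R]_d -> R) (F g : 'rV[R]_d -> prob2 R d -> R)
    (kappa theta A1 A2 B E E1 E2 T0 : R)
    (kappa_gt0 : 0 < kappa)
    (hH : Hassumption H) (hF : Fassumption kappa F) (hg : Fassumption kappa g)
    (htheta : 2 * kappa < theta)
    (A1_gt0 : 0 < A1) (A2_gt0 : 0 < A2) (B_gt0 : 0 < B) (E_gt0 : 0 < E)
    (E1_gt0 : 0 < E1) (E2_gt0 : 0 < E2) (T0_gt0 : 0 < T0)
    (hstanding : standing H F g theta A1 A2 B E E1 E2 T0) :
  exists2 T1 : R, 0 < T1 <= T0 &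
    forall (T s : R) (mu : prob2 R d), 0 < T <= T1 -> 0 < s < T ->
    forall Sigma1 Sigma2 : R -> 'rV[R]_d -> 'rV[R]_d,
      is_Sigma H F g theta A1 A2 B E E1 E2 T s mu Sigma1 Sigma2 ->
    let sigma := fun t => push (Sigma1 t) mu in
    forall X : R -> 'rV[R]_d -> 'rV[R]_d,
      (forall t, 0 <= t <= T -> torus_inverse (Sigma1 t) (X t)) ->
    forall z : R -> 'rV[R]_d -> R,
      (forall q, {within `[0, T[, continuous (z ^~ q)}) ->
      (forall t q, 0 < t < T ->
         is_derive t 1 (z ^~ q)
           (dot (Sigma2 t q) (gradp H (Sigma1 t q) (Sigma2 t q)) -
            H (Sigma1 t q) (Sigma2 t q) - F (Sigma1 t q) (sigma t))) ->
      (forall q, z 0 q = g (Sigma1 0 q) (sigma 0)) ->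
    let U := fun t q => z t (X t q) in
    classical_solution H F g T s mu U sigma.
Proof.
have [L L0 HL] := hamiltonian_gradient_bounds (theta * B) hH.
have K0 : 0 < 1 + L + kappa by rewrite ltr_wpDl ?addr_ge0.
(* The longest horizon that the stability estimate allows. *)
exists (Num.min T0 (16 * (1 + L + kappa) ^+ 3)^-1).
  by rewrite lt_min T0_gt0 invr_gt0 mulr_gt0 ?exprn_gt0 // ge_min lexx.
move=> T s mu /andP[T_gt0]; rewrite le_min => /andP[_ T_small] sT Q P [QP ham].
move=> sigma X Xinv z cz dz z0 U.
apply: (characteristics_solve_mfg hH hF hg (ltW kappa_gt0) L0 erefl _ HL sT
  (M0_Q_torus QP) (M0_P_torus QP) (M0_Q_cont QP) (M0_P_cont QP) (M0_P QP)
  ham Xinv cz dz z0).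
by rewrite -ler_pdivlMl ?mulr1 // mulr_gt0 ?exprn_gt0.
Qed.
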